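(* Let $v(n) := \max_{w \in \mathcal{L}_n} \Upsilon_w$, where $\mathcal{L}_n$ is the set of layered permutations in $S_n$. Then the limit $$\lim_{n\to\infty} \frac{1}{n^2}\log_2 v(n)$$ exists and equals $\gamma/\log 2 \approx 0.2932362762$. Moreover, the maximum value $v(n)$ is achieved at a layered permutation $w(\ldots,b_2,b_1)$ with $b_i \sim \alpha^{i-1}(1-\alpha)\,n$ as $n\to\infty$ for every fixed $i\ge 1$ (i.e. for each $n$ there is a maximizer $w(\ldots,b_2^{(n)},b_1^{(n)})\in\mathcal{L}_n$ with $b_i^{(n)}/n \to \alpha^{i-1}(1-\alpha)$ for every fixed $i$).
   Context: For $w\in S_n$ of length $\ell=\ell(w)$ (number of inversions), let $R(w)$ be the set of reduced words of $w$, i.e. tuples $(a_1,\ldots,a_\ell)$ with $w=s_{a_1}\cdots s_{a_\ell}$, $s_i=(i,i+1)$. The principal specialization of the Schubert polynomial is $\Upsilon_w := \mathfrak{S}_w(1,\ldots,1) = \frac{1}{\ell!}\sum_{(a_1,\ldots,a_\ell)\in R(w)} a_1\cdots a_\ell$. For positive integers $b_k,\ldots,b_1$ with $b_1+\cdots+b_k=n$, the layered permutation $w(b_k,b_{k-1},\ldots,b_1)\in S_n$ is, in one-line notation, $(b_k,b_k-1,\ldots,1,\ b_k+b_{k-1},b_k+b_{k-1}-1,\ldots,b_k+1,\ \ldots,\ n,n-1,\ldots,n-b_1+1)$: it consists of decreasing blocks of consecutive values, of sizes $b_k,\ldots,b_1$ from left to right (so $b_1$ is the size of the last block). Let $f(x)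 := x^2\log x - \frac12(1-x)^2\log(1-x) - \frac12(1+x)^2\log(1+x) + 2x\log 2$ (natural logarithms). The constant $\alpha\approx 0.4331818312$ is the solution in $(0,1)$ (other than $x=1$) of $2xf(x)+(1-x^2)f'(x)=0$, and $\gamma := f(\alpha)/(1-\alpha^2)\approx 0.2032558981$. *)

(* Defs.v *)
From HB Require Import structures.
From mathcomp Require Import all_boot all_order all_algebra all_fingroup.
From mathcomp Require Import all_classical all_reals all_analysis.
Set Implicit Arguments.
Unset Strict Implicit.
Unset Printing Implicit Defensive.
Import Order.TTheory GRing.Theory Num.Theory.
Import numFieldNormedType.Exports.
Local Open Scope ring_scope.

(* Permutations act on {0, ..., n-1}, and the letter a : 'I_n.-1 stands for
   the index a.+1 in {1, ..., n-1}: it exchanges the (0-based) points a and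
   a.+1. *)
Definition simple_transposition n (a : 'I_n.-1) : 'S_n :=
  tperm (widen_ord (leq_pred n) a)
        (Ordinal (etrans (esym (ltn_predRL a n)) (ltn_ord a))).

Definition perm_length n (w : 'S_n) : nat :=
  #|[set p : 'I_n * 'I_n | (p.1 < p.2)%N && (w p.2 < w p.1)%N]|.

(* MathComp composes permutations from left to right. With the opposite
   convention every reduced word is reversed, which does not affect the sum
   over reduced words in Upsilon. *)
Definition reduced_words n (w : 'S_n) : {set (perm_length w).-tuple 'I_n.-1} :=
  [set a : (perm_length w).-tuple 'I_n.-1
     | w == (\prod_(x <- a) simple_transposition x)%g].

(* The principal specialization of the Schubert polynomial of w, given by
   Macdonald's formula. *)
Definition Upsilon (R : realType) n (w : 'S_n) : R :=
  (\sum_(a in reduced_words w) \prod_(x <- a) (x : nat).+1)%N%:R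
    / ((perm_length w)`!)%:R.

Definition one_line n (w : 'S_n) : seq nat := [seq (w i).+1 | i <- enum 'I_n].

(* Consecutive decreasing blocks with sizes c, from left to right, on the
   values m+1, m+2, ... *)
Fixpoint layered_word (m : nat) (c : seq nat) : seq nat :=
  if c is p :: c' then rev (iota m.+1 p) ++ layered_word (m + p) c' else [::].

(* The block sizes are listed from the last block to the first:
   b = [:: b_1; b_2; ...; b_k], so that b_i is nth 0 b i.-1. *)
Definition is_layered_of n (b : seq nat) (w : 'S_n) : bool :=
  [&& all (leq 1) b, sumn b == n & one_line w == layered_word 0 (rev b)].

Definition layered n (w : 'S_n) : Prop := exists b, is_layered_of b w.

(* Upsilon is nonnegative and S_n contains a layered permutation, so the
   default value 0 of the iterated maximum is harmless. *)
Definition max_layered (R : realType) (n : nat) : R :=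
  \big[Num.max/0]_(w : 'S_n | `[< layered w >]) Upsilon R w.

(* Only used on the open interval ]0, 1[, where all logarithms are taken at
   positive reals. *)
Definition layered_f (R : realType) (x : R) : R :=
  x ^+ 2 * ln x - 2^-1 * (1 - x) ^+ 2 * ln (1 - x)
    - 2^-1 * (1 + x) ^+ 2 * ln (1 + x) + 2 * x * ln 2.

Definition critical_alpha (R : realType) (x : R) : Prop :=
  0 < x < 1 /\
  2 * x * layered_f x + (1 - x ^+ 2) * derive1 (@layered_f R) x = 0.

(* Main.v *)
(* Divided differences, acting on functions of s : 'S_n (values of polynomials
   at x_i = s i), satisfy the braid relations and square to zero. Hence the
   l-th power of T = sum_k k dd_k is the sum over the v of length l of
   (weighted number of reduced words of v) dd_v. For a layered w one may keep
   in T the letters inside the blocks only; then w is the only permutation of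
   its length which contributes, and dd_w maps the staircase monomial of the
   blocks to 1, so that l! Upsilon_w = T^l (staircase monomial).

   On monomials, T^l is computed by a determinant of binomial coefficients:
   a divided difference telescopes alternating forms, and T acts by Euler's
   identity for a homogeneous function. The determinant is block triangular
   with Vandermonde blocks, whence Upsilon_w is the product over the layers q
   of F(p, q) = prod_(i < q) prod_(j < i) (2p+i+j+1)/(i+j+1), where p is the
   total size of the layers on the left of q.

   So v(n) = max_q v(n - q) F(n - q, q), where ln F(p, q) is at most
   n^2 f(p / n) for n = p + q, with error O(n ln n). With gamma the maximum of
   f(x) / (1 - x^2), reached at alpha only, gap n = gamma n^2 - ln v(n) is
   nonnegative, o(n^2), and decreases by at least n^2 loss(p / n) when the last
   layer q is removed. This forces p / n to tend to alpha unless q = o(n). Small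
   layers are excluded since ln v(n + 1) - ln v(n) is at least c n, whereas a
   layer of size q = o(n) contributes only o(q n). The growth is proved by
   removing small last layers, which cannot go on below a fixed proportion of
   n because the gap would become negative, until the last layer is of size
   comparable with n: adding 1 to it then multiplies F by exp(c n). *)
Require Import Defs.
From HB Require Import structures.
From mathcomp Require Import all_boot all_order all_algebra all_fingroup.
From mathcomp Require Import all_classical all_reals all_analysis.
From mathcomp Require Import zify ring lra.
Set Implicit Arguments.
Unset Strict Implicit.
Unset Printing Implicit Defensive.
Import Order.TTheory GRing.Theory Num.Theory.
Import numFieldNormedType.Exports.
Local Open Scope ring_scope.

(** * Divided differences *)

Section DividedDifferences.
Variable n : nat.
Implicit Types (k l : 'I_n.-1) (v w s : 'S_n).

Definition lo k : 'I_n := widen_ord (leq_pred n) k.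
Definition hi k : 'I_n := Ordinal (etrans (esym (ltn_predRL k n)) (ltn_ord k)).
Local Notation st := (@simple_transposition n).

Lemma lo_neq_hi k : lo k != hi k.
Proof. by rewrite -val_eqE /= neq_ltn ltnSn. Qed.

Lemma st_lo k : st k (lo k) = hi k. Proof. exact: tpermL. Qed.
Lemma st_hi k : st k (hi k) = lo k. Proof. exact: tpermR. Qed.
Lemma stK k v : (st k * (st k * v) = v)%g.
Proof. by rewrite mulgA tperm2 mul1g. Qed.

Definition swap_succ (k i : nat) : nat :=
  if i == k then k.+1 else if i == k.+1 then k else i.

Lemma ltn_swap_succ (k i j : nat) : (i < j)%N -> ~~ ((i == k) && (j == k.+1)) ->
  (swap_succ k i < swap_succ k j)%N.
Proof.
move=> ij h; rewrite /swap_succ.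
by case: (i =P k); case: (i =P k.+1); case: (j =P k); case: (j =P k.+1); lia.
Qed.

Lemma val_st k (i : 'I_n) : st k i = swap_succ k i :> nat.
Proof.
rewrite /simple_transposition; case: tpermP => [->|->|].
- by rewrite /swap_succ /= eqxx.
- by rewrite /swap_succ /= eqxx ifN //; lia.
move=> /eqP; rewrite -val_eqE /swap_succ /= => /negbTE -> /eqP.
by rewrite -val_eqE /= => /negbTE ->.
Qed.

Definition inversions v : {set 'I_n * 'I_n} :=
  [set p : 'I_n * 'I_n | (p.1 < p.2)%N && (v p.2 < v p.1)%N].

(** Permutations act from left to right, so [st k * v] is [v] with the positions [k] and [k.+1]
    exchanged. Only the pair of these two positions changes its order. *)
Lemma inversions_st k v : (v (lo k) < v (hi k))%N ->
  inversions (st k * v)%g =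
    (lo k, hi k) |: [set (st k p.1, st k p.2) | p in inversions v].
Proof.
move=> vk; apply/setP => -[i j]; rewrite !inE /= !permM.
apply/idP/idP => [/andP[ij vij]|].
  have [->//|ne] := eqVneq (i, j) (lo k, hi k); apply/imsetP.
  exists (st k i, st k j); last by rewrite /= !tpermK.
  rewrite inE /= vij andbT !val_st.
  exact: ltn_swap_succ.
case/orP => [/eqP[-> ->]|/imsetP[[a b]]].
  by rewrite /= ltnS leqnn st_lo st_hi.
rewrite inE /= => /andP[ab vab] [-> ->]; rewrite /simple_transposition !tpermK vab andbT.
rewrite -!/(st k) !val_st.
apply: ltn_swap_succ => //.
apply: contraTN vk => /andP[/eqP ak /eqP bk]; rewrite -leqNgt ltnW //.
have -> : lo k = a by apply: val_inj; rewrite /= ak.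
by have -> : hi k = b by apply: val_inj; rewrite /= bk.
Qed.

Lemma perm_length_asc k v : (v (lo k) < v (hi k))%N ->
  perm_length (st k * v)%g = (perm_length v).+1.
Proof.
move=> vk; rewrite /perm_length -!/(inversions _) inversions_st // cardsU1.
rewrite card_imset ?[X in (~~ X + _)%N](_ : _ = false) //.
  apply/negP => /imsetP[[a b]]; rewrite inE /= => /andP[ab _] [ka kb].
  have: st k (lo k) = a by rewrite ka tpermK.
  have: st k (hi k) = b by rewrite kb tpermK.
  by rewrite st_lo st_hi => bE aE; move: ab; rewrite -aE -bE /= ltnNge leqnSn.
by move=> [a b] [c d] [/perm_inj -> /perm_inj ->].
Qed.

Lemma asc_desc k v : (v (lo k) < v (hi k))%N = ~~ (v (hi k) < v (lo k))%N.
Proof.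
have ne : nat_of_ord (v (lo k)) != v (hi k).
  by rewrite (inj_eq (@ord_inj _)) (inj_eq perm_inj) lo_neq_hi.
by rewrite -leqNgt ltn_neqAle ne.
Qed.

Lemma perm_length_desc k v : (v (hi k) < v (lo k))%N ->
  perm_length v = (perm_length (st k * v)%g).+1.
Proof.
move=> vk; rewrite -(@perm_length_asc k) ?stK //.
by rewrite !permM st_lo st_hi.
Qed.

Lemma perm_length1 : perm_length (1%g : 'S_n) = 0%N.
Proof.
apply: eq_card0 => -[i j]; rewrite !inE /= !perm1; lia.
Qed.

Variable R : realFieldType.
Implicit Types phi : 'S_n -> R.

Definition dd k phi s : R :=
  (phi s - phi (st k * s)%g) / ((s (lo k))%:R - (s (hi k))%:R).

Lemma perm_subr_neq0 s (i j : 'I_n) : i != j ->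
  (nat_of_ord (s i))%:R - (nat_of_ord (s j))%:R != 0 :> R.
Proof.
by move=> ij; rewrite subr_eq0 eqr_nat val_eqE (inj_eq perm_inj).
Qed.

Lemma dd_sq k phi : dd k (dd k phi) = fun=> 0.
Proof.
apply/funext => s; rewrite /dd stK !permM st_lo st_hi.
rewrite -(opprB (phi s)) -(opprB (s (lo k))%:R) invrN mulrNN subrr mul0r //.
Qed.

Lemma st_far k l (i : 'I_n) : (i != lo k) -> (i != hi k) -> st k i = i.
Proof. by move=> h1 h2; rewrite /simple_transposition tpermD // eq_sym. Qed.

Lemma val_st_far k (i : 'I_n) : i != k :> nat -> i != k.+1 :> nat -> st k i = i.
Proof. by move=> h1 h2; apply: st_far. Qed.

Lemma st_comm k l : (k.+1 < l)%N -> (st k * st l = st l * st k)%g.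
Proof.
move=> kl; suff stkl : (st k ^ st l)%g = st k by rewrite -[in RHS]stkl -conjgC.
rewrite /simple_transposition tpermJ -!/(st _) -!/(hi _) -!/(lo _).
by rewrite !val_st_far //=; lia.
Qed.

Lemma st_braid k l : l = k.+1 :> nat ->
  (st k * (st l * st k) = st l * (st k * st l))%g.
Proof.
move=> kl; have lol : lo l = hi k by apply: val_inj.
have stV j : ((st j)^-1 = st j)%g by exact: tpermV.
have -> : (st k * (st l * st k) = st l ^ st k)%g by rewrite conjgE stV.
have -> : (st l * (st k * st l) = st k ^ st l)%g by rewrite conjgE stV.
rewrite {1 3}/simple_transposition !tpermJ -!/(lo _) -!/(hi _) lol st_hi.
by rewrite -lol st_lo !val_st_far //=; lia.
Qed.

Lemma dd_comm k l phi : (k.+1 < l)%N -> dd k (dd l phi) = dd l (dd k phi).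
Proof.
move=> kl; apply/funext => s; rewrite /dd !permM.
rewrite !(val_st_far (k := k) (i := lo l)) ?(val_st_far (k := k) (i := hi l)) /=; try lia.
rewrite !(val_st_far (k := l) (i := lo k)) ?(val_st_far (k := l) (i := hi k)) /=; try lia.
rewrite !mulgA -(st_comm kl).
move: (_ - _)^-1 (_ - _)^-1 => x y.
by rewrite !mulrBl !opprB; ring.
Qed.

Lemma dd_braid k l phi : l = k.+1 :> nat ->
  dd k (dd l (dd k phi)) = dd l (dd k (dd l phi)).
Proof.
move=> kl; apply/funext => s; rewrite /dd !permM.
have lol : lo l = hi k by apply: val_inj.
have k1 : st k (hi l) = hi l by apply: val_st_far; rewrite /= kl; lia.
have l1 : st l (lo k) = lo k by apply: val_st_far; rewrite /= kl; lia.
have l2 : st l (hi k) = hi l by rewrite -lol st_lo.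
have l3 : st l (hi l) = hi k by rewrite -lol st_hi.
rewrite lol !(st_lo, st_hi, k1, l1, l2, l3) !stK.
have -> : (st k * (st l * (st k * s)) = st l * (st k * (st l * s)))%g.
  by have /(congr1 (fun t => (t * s)%g)) := st_braid kl; rewrite -!mulgA.
have := perm_subr_neq0 s (lo_neq_hi k); have := perm_subr_neq0 s (lo_neq_hi l).
have : lo k != hi l by rewrite -val_eqE /= kl; lia.
move=> /(perm_subr_neq0 s); rewrite lol -?kl.
set A := (nat_of_ord (s (lo k)))%:R; set B := (nat_of_ord (s (hi k)))%:R.
set C := (nat_of_ord (s (hi l)))%:R => nAC nBC nAB.
rewrite -(opprB A B) -(opprB B C) !invrN.
(* A partial fraction identity. The two sides of the braid relation differ by a multiple of
   [x * y - z * (x + y)], which it makes zero. *)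
have : (A - B)^-1 * (B - C)^-1 = (A - C)^-1 * ((A - B)^-1 + (B - C)^-1).
  apply: (mulfI nAC); rewrite mulrA [in RHS]mulrA mulfV // mul1r.
  have -> : A - C = (A - B) + (B - C) by ring.
  by move: (A - B) (B - C) nAB nBC => u v nu nv; field; rewrite nu nv.
move: (A - B)^-1 (B - C)^-1 (A - C)^-1 => x y z xyz.
apply: subr0_eq.
transitivity ((phi s * (x - y) - phi (st k * s)%g * x + phi (st l * s)%g * y)
  * (x * y - z * (x + y))); first by ring.
by rewrite xyz subrr mulr0.
Qed.

Section Family.
Variables (e : 'S_n -> R).

(* The fuel m is meant to be the length of v. *)
Fixpoint dd_family_rec (m : nat) (v : 'S_n) : 'S_n -> R :=
  if m is m'.+1 then
    if [pick k | (v (hi k) < v (lo k))%N] is Some k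
    then dd k (dd_family_rec m' (st k * v)%g) else e
  else e.
(** The operator of [v] along one particular reduced word, given by the picked descents.
    Independence of the picks is [dd_family_desc]. *)
Definition dd_family v := dd_family_rec (perm_length v) v.

Lemma dd_family1 : dd_family 1%g = e.
Proof. by rewrite /dd_family perm_length1. Qed.

Lemma dd_family_pick v k : (v (hi k) < v (lo k))%N ->
  exists2 k', (v (hi k') < v (lo k'))%N & dd_family v = dd k' (dd_family (st k' * v)%g).
Proof.
move=> vk; rewrite {1}/dd_family (perm_length_desc vk) /=.
case: pickP => [k' vk'|/(_ k)]; last by rewrite vk.
exists k' => //; congr (dd k' _); rewrite /dd_family; congr (dd_family_rec _ _).
by apply: succn_inj; rewrite -!perm_length_desc.
Qed.

(* Any two descents of v are the beginnings of two reduced words of v which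
   differ by a commutation or a braid relation: this is Matsumoto's theorem. *)
Lemma dd_family_desc v k : (v (hi k) < v (lo k))%N ->
  dd_family v = dd k (dd_family (st k * v)%g).
Proof.
have [m] := ubnP (perm_length v); elim: m v k => // m IH v k lm vk.
have [k' vk' vE] := dd_family_pick vk.
have sm j : (v (hi j) < v (lo j))%N -> (perm_length (st j * v)%g < m)%N.
  by move=> vj; move: lm; rewrite (perm_length_desc vj).
have [kk'|nkk'] := eqVneq k k'; first by rewrite {1}vE -kk'.
rewrite {}vE.
have far i j : (v (hi i) < v (lo i))%N -> (v (hi j) < v (lo j))%N -> (i.+1 < j)%N ->
    dd j (dd_family (st j * v)%g) = dd i (dd_family (st i * v)%g).
  move=> vi vj ij.
  rewrite [dd_family (st j * v)%g](IH _ i) ?sm //; last first.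
    by rewrite !permM !val_st_far //=; lia.
  rewrite [dd_family (st i * v)%g](IH _ j) ?sm //; last first.
    by rewrite !permM !val_st_far //=; lia.
  rewrite -dd_comm //; congr (dd _ (dd _ (dd_family _))).
  by have /(congr1 (fun t => (t * v)%g)) := st_comm ij; rewrite -!mulgA.
have adj i j : (v (hi i) < v (lo i))%N -> (v (hi j) < v (lo j))%N -> i.+1 = j :> nat ->
    dd j (dd_family (st j * v)%g) = dd i (dd_family (st i * v)%g).
  move=> vi vj ij.
  have loj : lo j = hi i by apply: ord_inj.
  have i1 : st i (hi j) = hi j by apply: val_st_far; rewrite /= -ij; lia.
  have j1 : st j (lo i) = lo i by apply: val_st_far; rewrite /= -ij; lia.
  have i2 : st i (lo j) = lo i by rewrite loj st_hi.
  have j2 : st j (hi i) = hi j by rewrite -loj st_lo.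
  (* Two adjacent descents make [v] decreasing on three consecutive positions, so either side of the
     braid relation can be split off from [v]. *)
  have vij : (v (hi j) < v (lo i))%N by rewrite (ltn_trans vj) // loj.
  have di : ((st i * v)%g (hi j) < (st i * v)%g (lo j))%N by rewrite !permM i1 i2.
  have dj : ((st j * v)%g (hi i) < (st j * v)%g (lo i))%N by rewrite !permM j1 j2.
  have li := perm_length_desc di; have lj := perm_length_desc dj.
  have mi := sm _ vi; have mj := sm _ vj.
  rewrite [dd_family (st j * v)%g](IH _ i) // [dd_family (st i * v)%g](IH _ j) //.
  rewrite (IH (st i * (st j * v))%g j); first last.
  - by rewrite !permM i1 i2 j1 st_hi loj.
  - by apply: leq_ltn_trans mj; rewrite lj.
  rewrite (IH (st j * (st i * v))%g i); first last.
  - by rewrite !permM j1 j2 i1 st_lo -loj.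
  - by apply: leq_ltn_trans mi; rewrite li.
  rewrite -dd_braid //; congr (dd _ (dd _ (dd _ (dd_family _)))).
  by have /(congr1 (fun t => (t * v)%g)) := st_braid (esym ij); rewrite -!mulgA.
have [lt|gt|eq] := ssrnat.ltngtP k k'; last by move/eqP: nkk'; case; apply: ord_inj.
- by move: lt; rewrite leq_eqVlt => /orP[/eqP|]; [apply: adj|apply: far].
- by apply/esym; move: gt; rewrite leq_eqVlt => /orP[/eqP|]; [apply: adj|apply: far].
Qed.

Lemma dd_family_asc v k : (v (lo k) < v (hi k))%N ->
  dd k (dd_family v) = dd_family (st k * v)%g.
Proof.
move=> vk; rewrite (@dd_family_desc (st k * v)%g k) ?stK //.
by rewrite !permM st_lo st_hi.
Qed.

Lemma dd_family_desc0 v k : (v (hi k) < v (lo k))%N -> dd k (dd_family v) = fun=> 0.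
Proof. by move=> vk; rewrite (dd_family_desc vk) dd_sq. Qed.

(** A new letter at an ascent lengthens the product and extends the family. At a descent the word is
    not reduced, and the result is zero because [dd] squares to zero. *)
Lemma dd_foldr (a : seq 'I_n.-1) :
  foldr dd e a =
    if perm_length (\prod_(x <- a) st x)%g == size a
    then dd_family (\prod_(x <- a) st x)%g else fun=> 0.
Proof.
have dd0 k : dd k (fun=> 0) = fun=> 0.
  by apply/funext => s; rewrite /dd subrr mul0r.
have len_le b : (perm_length (\prod_(x <- b) st x)%g <= size b)%N.
  elim: b => [|x b IH]; first by rewrite big_nil perm_length1.
  rewrite big_cons /=; set v := (\prod_(_ <- _) _)%g in IH *.
  have := asc_desc x v; case: ltnP => [vx _|_ /esym/negbFE vx].
    by rewrite perm_length_asc.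
  by have := perm_length_desc vx; lia.
elim: a => [|x a IH] /=; first by rewrite big_nil perm_length1 dd_family1.
rewrite {}IH big_cons; have := len_le a; set v := (\prod_(_ <- _) _)%g => vle.
have := asc_desc x v; case: ltnP => [vx _|_ /esym/negbFE vx].
  by rewrite perm_length_asc // eqSS; case: eqP => _; rewrite ?dd_family_asc ?dd0.
have lE := perm_length_desc vx.
have -> : (perm_length (st x * v)%g == (size a).+1) = false.
  by apply/eqP => h; move: vle; rewrite lE h; lia.
by case: eqP => _; rewrite ?dd_family_desc0 ?dd0.
Qed.
End Family.

End DividedDifferences.

(** * Sums over reduced words *)

Section WordSums.
Variables (n : nat) (R : realFieldType) (c : 'I_n.-1 -> R).
Implicit Types (k : 'I_n.-1) (v w s : 'S_n) (phi : 'S_n -> R).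
Local Notation st := (@simple_transposition n).

(** Weighted count of the words of length [j] with product [v], by recursion on the first letter.
    When [j] is the length of [v], these are its reduced words. *)
Fixpoint word_sum (j : nat) (v : 'S_n) : R :=
  if j is j'.+1 then \sum_k c k * word_sum j' (st k * v)%g else (v == 1%g)%:R.

Lemma word_sum_tuple j v :
  word_sum j v =
  \sum_(a : j.-tuple 'I_n.-1 | v == (\prod_(x <- a) st x)%g) \prod_(x <- a) c x.
Proof.
elim: j v => [|j IH] v /=.
  rewrite big_mkcond /= (big_pred1 [tuple]) /=; last first.
    by move=> a; apply/esym/eqP; rewrite [a]tuple0.
  by rewrite !big_nil; case: (v == 1%g).
pose h (p : 'I_n.-1 * j.-tuple 'I_n.-1) := [tuple of p.1 :: p.2].
rewrite [RHS](reindex h) /=; last first.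
  exists (fun t : j.+1.-tuple _ => (thead t, [tuple of behead t])) => [[x a] _|t _].
    by congr pair; apply: val_inj.
  by rewrite /h /= -tuple_eta.
rewrite (eq_bigr (fun k => \sum_(a : j.-tuple 'I_n.-1 |
  v == (\prod_(x <- k :: a) st x)%g) \prod_(x <- k :: a) c x)); last first.
  move=> k _; rewrite IH big_distrr /=; apply: eq_big => [a|a _].
    by rewrite big_cons -(inj_eq (mulgI (st k))) stK.
  by rewrite big_cons.
by rewrite pair_big_dep.
Qed.

Lemma word_sum_lt j v : (j < perm_length v)%N -> word_sum j v = 0.
Proof.
elim: j v => [|j IH] v lv /=.
  by case: eqP lv => // ->; rewrite perm_length1.
apply: big1 => k _; rewrite IH ?mulr0 //.
have := asc_desc k v; case: ssrnat.ltnP => [vk _|_ /esym/negbFE vk].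
  by rewrite perm_length_asc //; lia.
by move: lv; rewrite (perm_length_desc vk).
Qed.

Definition dd_op phi s : R := \sum_k c k * dd k phi s.

Lemma dd_sum (I : Type) (r : seq I) (b : I -> R) (f : I -> 'S_n -> R) k s :
  dd k (fun t => \sum_(i <- r) b i * f i t) s = \sum_(i <- r) b i * dd k (f i) s.
Proof.
rewrite /dd -sumrB mulr_suml; apply: eq_bigr => i _.
by rewrite -mulrBr mulrA.
Qed.

Lemma iter_dd_op_sum m (I : Type) (r : seq I) (b : I -> R) (f : I -> 'S_n -> R) :
  iter m dd_op (fun t => \sum_(i <- r) b i * f i t) =
  fun s => \sum_(i <- r) b i * iter m dd_op (f i) s.
Proof.
elim: m => //= m ->; apply/funext => s; rewrite /dd_op.
rewrite (eq_bigr (fun k => \sum_(i <- r) c k * (b i * dd k (iter m dd_op (f i)) s))).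
  rewrite exchange_big; apply: eq_bigr => i _; rewrite mulr_sumr.
  by apply: eq_bigr => k _; rewrite mulrCA.
by move=> k _; rewrite (dd_sum r b (fun i => iter m dd_op (f i))) mulr_sumr.
Qed.

(** In the expansion of the power, non-reduced words vanish and all reduced words of a given [v]
    yield the same operator. *)
Lemma iter_dd_op (e : 'S_n -> R) j s :
  iter j dd_op e s =
  \sum_(v | perm_length v == j) word_sum j v * dd_family e v s.
Proof.
elim: j s => [|j IH] s /=.
  rewrite (bigD1 1%g) /= ?perm_length1 // eqxx mul1r dd_family1 big1 ?addr0 //.
  by move=> v /andP[_ /negbTE->]; rewrite mul0r.
rewrite /dd_op (eq_bigr (fun k => \sum_(v | perm_length v == j.+1)
    c k * word_sum j (st k * v)%g * dd_family e v s)).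
  by rewrite exchange_big; apply: eq_bigr => v _; rewrite mulr_suml.
move=> k _; rewrite (_ : iter j dd_op e = fun s => \sum_v
    (if perm_length v == j then word_sum j v else 0) * dd_family e v s); last first.
  apply/funext => t; rewrite IH big_mkcond.
  by apply: eq_bigr => v _; case: ifP => //; rewrite mul0r.
rewrite (dd_sum _ _ (dd_family e)) (reindex_inj (mulgI (st k))) [RHS]big_mkcond mulr_sumr /=.
apply: eq_bigr => v _.
(* After reindexing, an ascent of [v] contributes zero on both sides; a descent is the first letter
   of reduced words of [v]. *)
have := asc_desc k v; case: ssrnat.ltnP => [vk _|_ /esym/negbFE vk].
  rewrite dd_family_desc0 ?mulr0; last by rewrite !permM st_lo st_hi.
  case: eqP => // lv; rewrite word_sum_lt ?mulr0 ?mul0r //.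
  by rewrite perm_length_asc // lv.
rewrite -dd_family_desc // (perm_length_desc vk) eqSS.
by case: ifP => _; rewrite ?mul0r ?mulr0 ?mulrA.
Qed.
End WordSums.

Lemma Upsilon_word_sum (R : realType) n (w : 'S_n) :
  Upsilon R w = word_sum (fun k : 'I_n.-1 => (k.+1)%:R) (perm_length w) w
    / ((perm_length w)`!)%:R.
Proof.
rewrite /Upsilon word_sum_tuple natr_sum; congr (_ / _).
by apply: eq_big => [a|a _]; rewrite ?inE // natr_prod.
Qed.

(** * A permutation is determined by its inversions *)

Section PermOfInversions.
Variable n : nat.

Lemma card_perm_lt (v : 'S_n) (i : 'I_n) : #|[set j : 'I_n | (v j < v i)%N]| = v i.
Proof.
rewrite -(card_imset _ (@perm_inj _ v)).
rewrite (_ : [set _ | _ in _] = [set j : 'I_n | (j < v i)%N]); last first.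
  apply/setP => j; rewrite !inE; apply/imsetP/idP => [[x]|jv].
    by rewrite inE => ? ->.
  by exists (v^-1 j)%g; rewrite ?inE permKV.
rewrite cardsE -sum1_card.
rewrite -(big_mkord (fun j => (j < v i)%N) (fun=> 1%N)) /=.
rewrite -(big_nat_widen 0 (v i) n xpredT); last exact: ltnW.
by rewrite sum_nat_const_nat subn0 muln1.
Qed.

(** The inversions tell which of any two values is smaller, and [v i] is the number of values below
    it. *)
Lemma inversions_inj (v w : 'S_n) : inversions v = inversions w -> v = w.
Proof.
move=> vw; apply/permP => i; apply: ord_inj; rewrite -(card_perm_lt v) -(card_perm_lt w).
apply: eq_card => j; rewrite !inE.
have [lt|gt|/ord_inj ->] := ssrnat.ltngtP i j; last by rewrite !ssrnat.ltnn.
  by have /setP/(_ (i, j)) := vw; rewrite !inE /= lt.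
have /setP/(_ (j, i)) := vw; rewrite !inE /= gt /= => e.
have ne (u : 'S_n) : nat_of_ord (u j) != u i.
  by rewrite (inj_eq (@ord_inj _)) (inj_eq perm_inj) -(inj_eq (@ord_inj _)) neq_ltn gt.
have lt u : (nat_of_ord ((u : 'S_n) j) < u i)%N = ~~ (u i < u j)%N.
  by rewrite -leqNgt ltn_neqAle ne.
by rewrite !lt e.
Qed.
End PermOfInversions.

(** * Monomials *)

Section Monomials.
Variables (n : nat) (R : realFieldType).
Implicit Types (k : 'I_n.-1) (v w s : 'S_n) (a : 'I_n -> nat).
Local Notation st := (@simple_transposition n).

Definition monom a s : R := \prod_i (s i)%:R ^+ a i.

Definition upd k a (x y : nat) : 'I_n -> nat :=
  fun i => if i == lo k then x else if i == hi k then y else a i.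

Lemma upd_id k a : upd k a (a (lo k)) (a (hi k)) = a.
Proof.
by apply/funext => i; rewrite /upd; case: eqP => [->//|_]; case: eqP => [->|].
Qed.

Lemma upd_lo k a x y : upd k a x y (lo k) = x.
Proof. by rewrite /upd eqxx. Qed.

Lemma upd_hi k a x y : upd k a x y (hi k) = y.
Proof. by rewrite /upd eq_sym (negbTE (lo_neq_hi k)) eqxx. Qed.

Lemma sum_upd k a x y :
  (\sum_i upd k a x y i = x + y + \sum_(i | (i != lo k) && (i != hi k)) a i)%N.
Proof.
rewrite (bigD1 (lo k)) //= (bigD1 (hi k)) /= 1?eq_sym ?lo_neq_hi //.
rewrite upd_lo upd_hi addnA; congr (_ + _)%N; apply: eq_bigr => i /andP[h1 h2].
by rewrite /upd (negbTE h1) (negbTE h2).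
Qed.

Lemma monom_upd k a x y s :
  monom (upd k a x y) s = (s (lo k))%:R ^+ x * (s (hi k))%:R ^+ y *
    \prod_(i | (i != lo k) && (i != hi k)) (s i)%:R ^+ a i.
Proof.
rewrite /monom (bigD1 (lo k)) //= (bigD1 (hi k)) /= 1?eq_sym ?lo_neq_hi //.
rewrite upd_lo upd_hi mulrA; congr (_ * _); apply: eq_bigr => i /andP[h1 h2].
by rewrite /upd (negbTE h1) (negbTE h2).
Qed.

Lemma monom_upd_st k a x y s :
  monom (upd k a x y) (st k * s)%g = monom (upd k a y x) s.
Proof.
rewrite !monom_upd !permM st_lo st_hi; congr (_ * _); first by rewrite mulrC.
by apply: eq_bigr => i /andP[h1 h2]; rewrite permM st_far.
Qed.

(** Once the common power [y] is split off, this is the factorization of a difference of two [d]-th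
    powers. *)
Lemma dd_monom_gt k a y d :
  dd k (monom (upd k a (y + d) y)) =
  fun s => \sum_(r < d) monom (upd k a (y + (d.-1 - r)) (y + r)) s.
Proof.
apply/funext => s; rewrite /dd monom_upd_st !monom_upd /=.
rewrite (eq_bigr _ (fun r _ => monom_upd k a _ _ s)).
have := perm_subr_neq0 R s (lo_neq_hi k).
set A := _%:R; set B := _%:R; set P := \prod_(_ | _) _ => nAB.
rewrite -mulr_suml -mulrBl mulrAC; congr (_ * _).
have -> : A ^+ (y + d) * B ^+ y - A ^+ y * B ^+ (y + d) =
  A ^+ y * B ^+ y * (A ^+ d - B ^+ d) by rewrite !exprD; ring.
rewrite subrXX mulrCA mulrC mulKf // mulr_sumr; apply: eq_bigr => r _.
by rewrite !exprD; ring.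
Qed.

Lemma dd_monom_lt k a y d :
  dd k (monom (upd k a y (y + d))) =
  fun s => - \sum_(r < d) monom (upd k a (y + (d.-1 - r)) (y + r)) s.
Proof.
apply/funext => s; have := congr1 (@^~ s) (dd_monom_gt k a y d) => /= <-.
by rewrite /dd !monom_upd_st -mulNr opprB.
Qed.

Lemma monom0 a : (forall i, a i = 0%N) -> monom a = fun=> 1.
Proof.
by move=> a0; apply/funext => s; rewrite /monom big1 // => i _; rewrite a0.
Qed.

End Monomials.

(* The value of the sum in dd_monom_gt for an alternating form. *)
Lemma alternating_telescope (R : realFieldType) (W : nat -> nat -> R) :
  (forall x y, W y x = - W x y) -> forall y d,
  \sum_(r < d) (W (y + (d.-1 - r)).+1 (y + r)%N - W (y + (d.-1 - r))%N (y + r)%N)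
  = W (y + d)%N y.
Proof.
move=> alt y d.
have alt0 x : W x x = 0.
  by have := alt x x => /eqP; rewrite -addr_eq0 -mulr2n mulrn_eq0 /= => /eqP.
elim/ltn_ind: d y => -[|[|d]] IH y.
- by rewrite big_ord0 addn0 alt0.
- by rewrite big_ord1 /= subn0 addn0 alt0 subr0 addn1.
(* Without its two extreme terms, the sum is the one for [y.+1] and [d]; the induction goes by steps
   of two. *)
rewrite big_ord_recr big_ord_recl /= subnn subn0 !addn0.
rewrite (eq_bigr (fun r : 'I_d => W (y.+1 + (d.-1 - r)).+1 (y.+1 + r)%N
   - W (y.+1 + (d.-1 - r))%N (y.+1 + r)%N)); last first.
  move=> r _; rewrite /bump /=; congr (W _ _ - W _ _); have := ltn_ord r; lia.
rewrite IH; last by rewrite ltnS leqnSn.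
rewrite (alt (y + d.+1)%N (y.+1)) (alt (y + d.+1)%N y).
have -> : (y.+1 + d = y + d.+1)%N by lia.
have -> : (y + d.+2 = (y + d.+1).+1)%N by lia.
ring.
Qed.

(** * The operator of a block structure, where [en i] is the excluded end of the block of position
    [i] *)

Section Blocks.
Variables (n : nat) (R : realFieldType) (en : nat -> nat).
Hypothesis en_gt : forall i, (i < n)%N -> (i < en i <= n)%N.
Hypothesis en_eq : forall i j, (j < n)%N -> (i <= j)%N -> (j < en i)%N -> en j = en i.
Implicit Types (k : 'I_n.-1) (v s : 'S_n) (a : 'I_n -> nat).
Local Notation st := (@simple_transposition n).

Definition inner k := en k == en k.+1.

Lemma en_mono i j : (j < n)%N -> (i <= j)%N -> (en i <= en j)%N.
Proof.
move=> jn ij; have [lt|le] := ssrnat.ltnP j (en i); first by rewrite (en_eq jn ij).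
by rewrite (leq_trans le) // ltnW //; have /andP[] := en_gt jn.
Qed.

Definition block_weight k : R := if inner k then (k.+1)%:R else 0.

Lemma en_st k (i : 'I_n) : inner k -> en (st k i) = en i.
Proof.
move=> /eqP ek; rewrite val_st /swap_succ; case: eqP => [->//|_].
by case: eqP => [->|].
Qed.

(** A reduced word starts with a descent, which here lies inside a block. Removing it leaves a
    permutation whose inversions are still inside the blocks. *)
Lemma word_sum_block v :
  (forall i j : 'I_n, (i < j)%N -> (v j < v i)%N -> en i = en j) ->
  word_sum block_weight (perm_length v) v =
  word_sum (fun k => (k.+1)%:R) (perm_length v) v.
Proof.
have [m] := ubnP (perm_length v); elim: m v => // m IH v lm vb.
case lv : (perm_length v) => [//|l] /=; apply: eq_bigr => k _.
have := asc_desc k v; case: ssrnat.ltnP => [vk _|_ /esym/negbFE vk].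
  by rewrite !word_sum_lt ?mulr0 // perm_length_asc // lv ltnS leqnSn.
have ik : inner k by apply/eqP; rewrite (vb (lo k) (hi k)).
have ll : perm_length (st k * v)%g = l by apply: succn_inj; rewrite -perm_length_desc.
rewrite /block_weight ik -ll IH //; first by rewrite ll; rewrite lv in lm.
move=> i j ij; rewrite !permM => vij.
have [e|ne] := eqVneq (i, j) (lo k, hi k); first by move: e ik => [-> ->] /eqP.
rewrite -(en_st i ik) -(en_st j ik); apply: vb => //.
by rewrite !val_st ltn_swap_succ.
Qed.

Definition en_stable v := [forall i, en (v i) == en i].

Lemma en_stable_st k v : inner k -> en_stable (st k * v)%g = en_stable v.
Proof.
move=> ik; apply/forallP/forallP => h i.
  have := h (st k i); rewrite permM en_st // => /eqP <-.
  by rewrite /simple_transposition tpermK.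
by rewrite permM (eqP (h _)) en_st.
Qed.

Lemma en_stable1 : en_stable 1%g.
Proof. by apply/forallP => i; rewrite perm1. Qed.

Lemma word_sum_stable j v : ~~ en_stable v -> word_sum block_weight j v = 0.
Proof.
elim: j v => [|j IH] v nv /=.
  by case: eqP nv => // ->; rewrite en_stable1.
apply: big1 => k _; rewrite /block_weight; case: ifP => ik; last by rewrite mul0r.
by rewrite IH ?mulr0 // en_stable_st.
Qed.

Variable w : 'S_n.
Hypothesis w_inv :
  forall i j : 'I_n, (i < j)%N -> (w j < w i)%N = (en i == en j).

(** A permutation preserving the blocks has its inversions inside them, and there [w] inverts every
    pair. Equal lengths thus force equal sets of inversions. *)
Lemma en_stable_max v : en_stable v -> perm_length v = perm_length w -> v = w.
Proof.
move=> /forallP sv lv; apply: inversions_inj.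
apply/eqP; rewrite eqEcard -!/(perm_length _) lv leqnn andbT.
apply/fintype.subsetP => -[i j]; rewrite !inE /= => /andP[ij vij]; rewrite ij w_inv //.
rewrite eqn_leq (en_mono (ltn_ord j) (ltnW ij)) -(eqP (sv i)) -(eqP (sv j)).
by apply: en_mono => //; apply: ltnW.
Qed.

(** The exponent at [i] is the number of later positions in its block. *)
Definition stair (i : 'I_n) : nat := (en i - i.+1)%N.

Lemma perm_length_stair : perm_length w = (\sum_i stair i)%N.
Proof.
rewrite /perm_length -sum1_card (eq_bigl (fun p : 'I_n * 'I_n =>
    true && ((p.1 < p.2)%N && (en p.1 == en p.2)))); last first.
  by move=> [i j]; rewrite !inE /=; case: ssrnat.ltnP => //= /w_inv ->.
rewrite -(pair_big_dep xpredT (fun i j : 'I_n => (i < j)%N && (en i == en j))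
  (fun _ _ => 1%N)) /=; apply: eq_bigr => i _.
have /andP[igt ile] := en_gt (ltn_ord i).
rewrite /stair -[RHS]muln1 -sum_nat_const_nat (big_nat_widenl _ 0) //.
rewrite (big_nat_widen _ _ n) // big_mkord; apply: eq_bigl => j /=.
case: (ssrnat.ltnP i j) => //= ij.
apply/eqP/idP => [->|lt]; first by have /andP[] := en_gt (ltn_ord j).
by rewrite (en_eq (ltn_ord j) (ltnW ij) lt).
Qed.

Lemma stair_succ k : inner k -> stair (lo k) = (stair (hi k)).+1.
Proof.
move=> /eqP ik; rewrite /stair /= -ik.
have /andP[] := en_gt (ltn_ord (hi k)); rewrite /= -ik => h _.
by rewrite subnSK.
Qed.

(* Lowering the last maximal exponent is always a divided difference step. *)
Lemma monom_word a :
  (forall k, inner k -> (a (lo k) <= (a (hi k)).+1)%N) ->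
  (forall i : 'I_n, en i = i.+1 -> a i = 0%N) ->
  exists b : seq 'I_n.-1,
    [/\ all inner b, size b = (\sum_i a i)%N & foldr (@dd n R) (monom R a) b = fun=> 1].
Proof.
move sE : (\sum_i a i)%N => m; elim: m a sE => [|m IH] a sE step last0.
  exists [::]; split => //=; apply: monom0 => i.
  by move/eqP: sE; rewrite sum_nat_eq0 => /forall_inP/(_ i isT)/eqP.
have [i0 ai0] : exists i0, (0 < a i0)%N.
  have [i0 ai0|h] := pickP (fun i => 0 < a i)%N; first by exists i0.
  by move: sE; rewrite big1 // => i _; have := h i; rewrite lt0n => /negbFE/eqP.
case: (@arg_maxnP _ i0 xpredT a isT) => i1 _ i1max.
case: (@arg_maxnP _ i1 (fun i => a i == a i1) (@nat_of_ord n) (eqxx _)) => i /eqP imax ilast.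
have amax j : (a j <= a i)%N by rewrite imax; apply: i1max.
have agt : (0 < a i)%N by rewrite (leq_trans ai0).
have /andP[igt ile] := en_gt (ltn_ord i).
have ilt : (i.+1 < en i)%N.
  rewrite ltn_neqAle igt andbT; apply: contraTneq agt => e.
  by rewrite last0.
have in1 : (i < n.-1)%N by rewrite ltn_predRL (leq_trans ilt ile).
pose k := Ordinal in1.
have lok : lo k = i by apply: ord_inj.
have ik : inner k by apply/eqP; rewrite (en_eq (i := i) (j := i.+1)) //; lia.
(* As [i] is the last index of maximal exponent, the exponent drops after it, and [step] allows a
   drop by one only. *)
have ahi : a (lo k) = (a (hi k)).+1.
  apply/eqP; rewrite eqn_leq step //= lok ltn_neqAle amax andbT.
  apply/negP => /eqP e; have := ilast (hi k); rewrite -imax e eqxx => /(_ isT).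
  by rewrite /= ltnn.
pose a' := upd k a (a (hi k)) (a (hi k)).
have a'E j : a' j = if j == lo k then (a j).-1 else a j.
  rewrite /a' /upd; case: eqP => [->|_]; first by rewrite ahi.
  by case: eqP => [->|].
have sa' : (\sum_i a' i)%N = m.
  apply: succn_inj; rewrite -sE -[in RHS](upd_id k a) !sum_upd ahi.
  by rewrite !addSn.
have [|j ej|b [bK sb db]] := IH a' sa'.
- move=> l il; rewrite !a'E; have := step l il.
  case: eqP => e1; case: eqP => e2; rewrite ?e2; have := amax (lo l); rewrite -lok; try lia.
- by rewrite a'E last0 // if_same.
exists (rcons b k); split; first by rewrite all_rcons ik.
  by rewrite size_rcons sb.
rewrite foldr_rcons -[RHS]db; congr foldr.
rewrite -{1}(upd_id k a) ahi -addn1 (dd_monom_gt R k a _ 1).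
by apply/funext => s; rewrite big_ord1 /= subn0 !addn0.
Qed.

(** The word given by [monom_word] sends the staircase monomial to 1. It is therefore reduced, since
    it would otherwise give 0, and its length then forces its product to be [w]. *)
Lemma dd_family_stair : dd_family (monom R stair) w = fun=> 1.
Proof.
have [k ik|i ei|b [bK sb db]] := @monom_word stair.
- by rewrite stair_succ.
- by rewrite /stair ei subnn.
have stb : en_stable (\prod_(x <- b) st x)%g.
  elim: b bK {sb db} => [|x b IH] /=; first by rewrite big_nil en_stable1.
  by case/andP => ix ib; rewrite big_cons en_stable_st // IH.
move: db; rewrite dd_foldr; case: eqP => [lb|_].
  by rewrite (en_stable_max stb) // lb sb perm_length_stair.
move=> /(congr1 (@^~ 1%g)) /eqP; rewrite eq_sym oner_eq0 //.
Qed.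

(** With block weights, only products preserving the blocks contribute, and [w] is the only one of
    its length. *)
Lemma iter_dd_op_stair :
  iter (perm_length w) (dd_op block_weight) (monom R stair) =
  fun=> word_sum (fun k => (k.+1)%:R) (perm_length w) w.
Proof.
apply/funext => s; rewrite iter_dd_op (bigD1 w) //= big1 ?addr0 => [|v /andP[/eqP lv vw]].
  rewrite dd_family_stair mulr1 word_sum_block // => i j ij.
  by rewrite w_inv // => /eqP.
rewrite word_sum_stable ?mul0r //; apply: contra vw => sv.
by rewrite (en_stable_max sv lv).
Qed.

End Blocks.

(** * The determinant of a block structure *)

Lemma sum_lo (V : nmodType) n (F : 'I_n -> V) :
  (forall i : 'I_n, i.+1 = n -> F i = 0) -> \sum_(k < n.-1) F (lo k) = \sum_i F i.
Proof.
case: n F => [|m] F F0; first by rewrite !big_ord0.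
rewrite big_ord_recr /= F0 // addr0.
by apply: eq_bigr => i _; congr F; apply: ord_inj.
Qed.

Section BlockDeterminant.
Variables (n : nat) (R : realFieldType) (en : nat -> nat).
Hypothesis en_gt : forall i, (i < n)%N -> (i < en i <= n)%N.
Hypothesis en_eq : forall i j, (j < n)%N -> (i <= j)%N -> (j < en i)%N -> en j = en i.
Implicit Types (k : 'I_n.-1) (s : 'S_n) (a : 'I_n -> nat).

Local Notation inner := (inner en).

(* Up to a change of basis of the columns, the entry in row i is the residue of
   a monomial of exponent a i, divided by a power of t - 1 which grows with i. *)
Definition binom_mx a : 'M[R]_n :=
  \matrix_(i, j) (if en i == en j then 'C(a i + j, a i + en i - i.+1)%:R else 0).

(** For an inner [k], this is the row of [binom_mx] at position [hi k] with exponent [x]. Using the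
    same form for both rows in [two_rows] makes its determinant alternating in the two exponents. *)
Definition binom_row k (x j : nat) : R :=
  if en k == en j then 'C(x + j, x + en k - k.+2)%:R else 0.

Definition raised_mx k a : 'M[R]_n :=
  \matrix_(i, j) (if i == lo k then binom_row k (a (lo k)) j else binom_mx a i j).

Definition two_rows k a x y : 'M[R]_n :=
  \matrix_(i, j) (if i == lo k then binom_row k x j
    else if i == hi k then binom_row k y j else binom_mx a i j).

Lemma two_rows_alt k a x y : \det (two_rows k a y x) = - \det (two_rows k a x y).
Proof.
have -> : two_rows k a y x = row_perm (simple_transposition k) (two_rows k a x y).
  apply/matrixP => i j; rewrite !mxE.
  have nl : (hi k == lo k) = false by rewrite eq_sym (negbTE (lo_neq_hi k)).
  have [->|n1] := eqVneq i (lo k); first by rewrite st_lo nl eqxx.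
  have [->|n2] := eqVneq i (hi k); first by rewrite st_hi eqxx.
  by rewrite st_far // (negbTE n1) (negbTE n2).
rewrite row_permE det_mulmx det_perm odd_tperm lo_neq_hi.
by rewrite expr1 mulN1r.
Qed.

Lemma inner_end k : inner k -> (k.+1 < en k)%N.
Proof. by move=> /eqP ->; have /andP[] := en_gt (ltn_ord (hi k)). Qed.

(** By Pascal's rule, the row [lo k] of [binom_mx] is the difference of the rows [binom_row] for
    [x.+1] and [x]. *)
Lemma det_upd k a x y : inner k ->
  \det (binom_mx (upd k a x y)) =
  \det (two_rows k a x.+1 y) - \det (two_rows k a x y).
Proof.
move=> ik; have ek := eqP ik; have kl := inner_end ik.
have nl : (hi k == lo k) = false by rewrite eq_sym (negbTE (lo_neq_hi k)).
have same x' : row' (lo k) (two_rows k a x' y) = row' (lo k) (binom_mx (upd k a x y)).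
  apply/matrixP => i j; rewrite !mxE /upd.
  have -> : (lift (lo k) i == lo k) = false by rewrite eq_sym (negbTE (neq_lift _ _)).
  by have [->|//] := eqVneq (lift (lo k) i) (hi k); rewrite /binom_row /= -ek.
rewrite (@determinant_multilinear _ _ _ (two_rows k a x.+1 y) (two_rows k a x y)
  (lo k) 1 (-1)) ?mul1r ?mulN1r //.
apply/rowP => j; rewrite !mxE eqxx upd_lo /binom_row /=.
case: ifP => _; last by rewrite !mulr0 addr0.
rewrite mul1r mulN1r addSn.
have -> : (x.+1 + en k - k.+2 = (x + en k - k.+2).+1)%N by lia.
have -> : (x + en k - k.+1 = (x + en k - k.+2).+1)%N by lia.
by rewrite binS natrD addrK.
Qed.

Lemma det_raised k a : inner k ->
  \det (raised_mx k a) = \det (two_rows k a (a (lo k)) (a (hi k))).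
Proof.
move=> ik; congr (\det _); apply/matrixP => i j; rewrite !mxE.
have [//|_] := eqVneq i (lo k); have [->|//] := eqVneq i (hi k).
by rewrite /binom_row /= -(eqP ik).
Qed.

(** The determinants of the monomials in [dd k] telescope to that of [raised_mx]. The formula for
    [f] is asked only for these monomials, described by their degree and maximal exponent, so that
    an induction hypothesis can supply it. *)
Lemma dd_sum_det k a (f : ('I_n -> nat) -> R) (g : R) : inner k ->
  (forall b, (exists x y, b = upd k a x y /\
     (x + y = (a (lo k) + a (hi k)).-1)%N /\ (maxn x y < maxn (a (lo k)) (a (hi k)))%N) ->
   f b = g * \det (binom_mx b)) ->
  exists (I : finType) (c : R) (b : I -> 'I_n -> nat),
    dd k (monom R a) = (fun s => \sum_i c * monom R (b i) s) /\
    \sum_i c * f (b i) = g * \det (raised_mx k a).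
Proof.
move=> ik fE; rewrite det_raised //.
have alt := alternating_telescope (two_rows_alt k a).
have [le|lt] : (a (hi k) <= a (lo k))%N \/ (a (lo k) < a (hi k))%N by lia.
  pose d := (a (lo k) - a (hi k))%N; pose y := a (hi k).
  have ly : a (lo k) = (y + d)%N by rewrite /y /d subnKC.
  pose b (r : 'I_d) := upd k a (y + (d.-1 - r)) (y + r).
  have bE r : exists x z, b r = upd k a x z /\
     (x + z = (a (lo k) + a (hi k)).-1)%N /\ (maxn x z < maxn (a (lo k)) (a (hi k)))%N.
    exists (y + (d.-1 - r))%N, (y + r)%N; split => //.
    by have := ltn_ord r; rewrite ly -/y; lia.
  exists 'I_d, 1, b; split.
    apply/funext => s; rewrite -{1}(upd_id k a) ly -/y dd_monom_gt.
    by apply: eq_bigr => r _; rewrite mul1r.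
  rewrite ly -/y -alt mulr_sumr; apply: eq_bigr => r _.
  by rewrite mul1r fE // det_upd.
pose d := (a (hi k) - a (lo k))%N; pose y := a (lo k).
have ly : a (hi k) = (y + d)%N by rewrite /y /d subnKC // ltnW.
pose b (r : 'I_d) := upd k a (y + (d.-1 - r)) (y + r).
have bE r : exists x z, b r = upd k a x z /\
   (x + z = (a (lo k) + a (hi k)).-1)%N /\ (maxn x z < maxn (a (lo k)) (a (hi k)))%N.
  exists (y + (d.-1 - r))%N, (y + r)%N; split => //.
  by have := ltn_ord r; rewrite ly -/y; lia.
exists 'I_d, (-1), b; split.
  apply/funext => s; rewrite -{1}(upd_id k a) ly -/y dd_monom_lt -sumrN.
  by apply: eq_bigr => r _; rewrite mulN1r.
rewrite ly -/y two_rows_alt -alt mulrN mulr_sumr -sumrN; apply: eq_bigr => r _.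
by rewrite mulN1r fE // det_upd.
Qed.

Lemma sum_col_cofactor (A : 'M[R]_n) (j j' : 'I_n) :
  \sum_i A i j * cofactor A i j' = \det A *+ (j == j').
Proof.
have := congr1 (fun M : 'M[R]_n => M j' j) (mul_adj_mx A); rewrite !mxE eq_sym => <-.
by apply: eq_bigr => i _; rewrite !mxE mulrC.
Qed.

Lemma det_raised_row k a :
  \det (raised_mx k a) =
  \sum_(j < n) binom_row k (a (lo k)) j * cofactor (binom_mx a) (lo k) j.
Proof.
rewrite (expand_det_row _ (lo k)); apply: eq_bigr => j _; rewrite !mxE eqxx.
congr (_ * _); rewrite /cofactor; congr (_ * \det _); apply/matrixP => i i'.
by rewrite !mxE eq_sym (negbTE (neq_lift _ _)).
Qed.

(** The column is a natural number because [euler_entry] also reads the column [j.+1]. *)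
Definition binom_entry a (i : 'I_n) (j : nat) : R :=
  if en i == en j then 'C(a i + j, a i + en i - i.+1)%:R else 0.

(* Euler's identity for the degree in row i. *)
Definition euler_entry a (i j : 'I_n) : R :=
  (a i + (en i - i.+1))%:R * binom_entry a i j
  + (en j - j.+1)%:R * (binom_entry a i j.+1 - binom_entry a i j).

Lemma en_succ (j : 'I_n) : (j.+1 < en j)%N -> en j.+1 = en j.
Proof.
move=> lt; apply: en_eq => //; apply: leq_trans lt _.
by have /andP[] := en_gt (ltn_ord j).
Qed.

(** Pascal's rule turns the difference of columns into ['C(x + j, r)]. Together with [mul_bin_left],
    the total factor is [k.+1], independent of [j]. *)
Lemma euler_inner k a (j : 'I_n) : inner k ->
  euler_entry a (lo k) j = (k.+1)%:R * binom_row k (a (lo k)) j.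
Proof.
move=> ik; have kl := inner_end ik; rewrite /euler_entry /binom_entry /binom_row /=.
have /andP[jl jn] := en_gt (ltn_ord j).
case: (en k =P en j) => [ekj|nkj]; last first.
  rewrite !mulr0 add0r subr0; case: ifP => [/eqP e|_]; last by rewrite mulr0.
  have [->|ne] := eqVneq (en j) j.+1; first by rewrite subnn mul0r.
  by case: nkj; rewrite e en_succ // ltn_neqAle eq_sym ne.
set x := a (lo k); set r := (x + en k - k.+2)%N.
have rE : (x + en k - k.+1 = r.+1)%N by rewrite /r; lia.
have r2E : (x + (en k - k.+1) = r.+1)%N by rewrite /r; lia.
rewrite rE r2E -natrM mul_bin_left.
have D : (en j - j.+1)%:R *
     ((if en k == en j.+1 then 'C(x + j.+1, r.+1)%:R else 0) - 'C(x + j, r.+1)%:R)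
   = (en j - j.+1)%:R * 'C(x + j, r)%:R :> R.
  have [->|ne] := eqVneq (en j) j.+1; first by rewrite subnn !mul0r.
  have jlt : (j.+1 < en j)%N by rewrite ltn_neqAle eq_sym ne.
  by rewrite en_succ // ekj eqxx addnS binS natrD addrAC subrr add0r.
rewrite D natrM -mulrDl -natrD.
have [le|lt] := ssrnat.leqP r (x + j).
  by congr (_%:R * _); rewrite /r; lia.
by rewrite bin_small // !mulr0.
Qed.

Lemma euler_last a (i j : 'I_n) : en i = i.+1 -> a i = 0%N -> euler_entry a i j = 0.
Proof.
move=> ei ai; rewrite /euler_entry ai ei subnn mul0r add0r /binom_entry ai ei.
have [ej|ne] := eqVneq (en j) j.+1; first by rewrite ej subnn mul0r.
have /andP[jl jn] := en_gt (ltn_ord j).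
have jlt : (j.+1 < en j)%N by rewrite ltn_neqAle eq_sym ne.
by rewrite en_succ // !add0n subnn !bin0 subrr mulr0.
Qed.

(** Expanding along columns, a column [j.+1] against the cofactors of [j] gives zero. The
    contributions of [en i - i.+1] from rows and columns cancel, which leaves the exponents. *)
Lemma sum_euler a :
  \sum_i \sum_j euler_entry a i j * cofactor (binom_mx a) i j =
  (\sum_i a i)%:R * \det (binom_mx a).
Proof.
pose A := binom_mx a.
have AE i (j : 'I_n) : binom_entry a i j = A i j by rewrite mxE.
rewrite (eq_bigr (fun i => (a i + (en i - i.+1))%:R * \det A +
  \sum_(j < n) (en j - j.+1)%:R * (binom_entry a i j.+1 - A i j) * cofactor A i j)); last first.
  move=> i _; rewrite [\det A](expand_det_row _ i) mulr_sumr -big_split /=.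
  by apply: eq_bigr => j _; rewrite -/A /euler_entry -!AE; ring.
rewrite big_split /= exchange_big /= -mulr_suml -natr_sum big_split /= natrD mulrDl.
rewrite -[RHS]addr0 -addrA; congr (_ + _).
rewrite natr_sum mulr_suml -big_split /= big1 // => j _.
have [ej|ne] := eqVneq (en j) j.+1.
  by rewrite ej subnn mul0r add0r big1 // => i _; rewrite !mul0r.
have /andP[jl jn] := en_gt (ltn_ord j).
have jlt : (j.+1 < en j)%N by rewrite ltn_neqAle eq_sym ne.
have j1n : (j.+1 < n)%N by apply: leq_trans jlt jn.
rewrite (eq_bigr (fun i => (en j - j.+1)%:R * (A i (Ordinal j1n) * cofactor A i j) -
    (en j - j.+1)%:R * (A i j * cofactor A i j))); last first.
  by move=> i _; rewrite -!AE /=; ring.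
rewrite sumrB -!mulr_sumr !sum_col_cofactor eqxx -val_eqE /=.
by rewrite (negbTE (_ : j.+1 != j)) ?mulr0n ?mulr0 ?add0r ?mulr1n ?subrr // neq_ltn ltnSn orbT.
Qed.

Definition admissible a := forall i : 'I_n, (a i <= en i - i.+1)%N.

(** The Euler row of [lo k] is [k.+1] times the raised row when [k] is inner. The last position of a
    block has exponent 0 by admissibility, and its Euler row vanishes. *)
Lemma sum_raised a : admissible a ->
  \sum_k block_weight R en k * \det (raised_mx k a) =
  (\sum_i a i)%:R * \det (binom_mx a).
Proof.
move=> adm; rewrite -sum_euler.
pose F (i : 'I_n) := \sum_j euler_entry a i j * cofactor (binom_mx a) i j.
have Flast (i : 'I_n) : en i = i.+1 -> F i = 0.
  move=> ei; apply: big1 => j _; rewrite euler_last ?mul0r //.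
  by have := adm i; rewrite ei subnn leqn0 => /eqP.
rewrite (eq_bigr (fun k => F (lo k))).
  apply: sum_lo => i ni; apply: Flast.
  by have /andP[] := en_gt (ltn_ord i); lia.
move=> k _; rewrite /block_weight; case: ifP => ik.
  rewrite det_raised_row mulr_sumr; apply: eq_bigr => j _.
  by rewrite euler_inner // mulrA.
rewrite mul0r Flast //=; apply/eqP/negPn/negP => ne.
have /andP[kl kn] := en_gt (ltn_ord (lo k)).
move/negP: ik; apply; apply/eqP/esym; apply: (en_succ (j := lo k)).
by rewrite ltn_neqAle eq_sym ne.
Qed.

(** Induction on the degree: [dd_sum_det] expands one application of the operator, and [sum_raised]
    recombines the determinants with the degree as a factor, whence the factorial. *)
Lemma iter_dd_op_monom a s : admissible a ->
  iter (\sum_i a i)%N (dd_op (block_weight R en)) (monom R a) s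
    * \det (binom_mx (fun=> 0%N)) =
  ((\sum_i a i)`!)%:R * \det (binom_mx a).
Proof.
move sE : (\sum_i a i)%N => m; elim: m a sE s => [|m IH] a sE s adm.
  have a0 i : a i = 0%N.
    by move/eqP: sE; rewrite sum_nat_eq0 => /forall_inP/(_ i isT)/eqP.
  rewrite /= monom0 // mul1r fact0 mul1r; congr (\det (binom_mx _)).
  by apply/funext.
rewrite iterSr /dd_op iter_dd_op_sum mulr_suml factS natrM -mulrA [_%:R * (_ * _)]mulrCA.
rewrite -sE -sum_raised // mulr_sumr; apply: eq_bigr => k _.
rewrite /block_weight; case: ifP => ik; last by rewrite !mul0r mulr0.
pose f b := iter m (dd_op (block_weight R en)) (monom R b) s * \det (binom_mx (fun=> 0%N)).
have [|I [c [b [ddE fE]]]] := @dd_sum_det k a f (m`!)%:R ik.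
  move=> b [x [y [-> [xy mxy]]]]; apply: IH.
    by move: sE; rewrite -[in X in X -> _](upd_id k a) !sum_upd xy; lia.
  (* The bound at [hi k] is one less than that at [lo k]; the strict decrease of the maximal
     exponent keeps both positions admissible. *)
  move=> i; rewrite /upd; have := adm i; have := adm (lo k); have := adm (hi k).
  have := inner_end ik; rewrite -(eqP ik : en k = en (hi k)) /=.
  case: eqP => [->|_]; first by rewrite /=; lia.
  by case: eqP => [->|_] //=; rewrite -(eqP ik : en k = en k.+1); lia.
rewrite -mulrA [RHS]mulrCA -fE ddE iter_dd_op_sum; congr (_ * _).
by rewrite mulr_suml; apply: eq_bigr => i _; rewrite /f mulrA.
Qed.

Lemma admissible_stair : admissible (stair en).
Proof. by []. Qed.

End BlockDeterminant.

(** The degree of the staircase monomial is the length of [w], so the factorial cancels the one in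
    [Upsilon]. *)
Lemma Upsilon_det (R : realType) n (en : nat -> nat) (w : 'S_n) :
  (forall i, (i < n)%N -> (i < en i <= n)%N) ->
  (forall i j, (j < n)%N -> (i <= j)%N -> (j < en i)%N -> en j = en i) ->
  (forall i j : 'I_n, (i < j)%N -> (w j < w i)%N = (en i == en j)) ->
  Upsilon R w * \det (@binom_mx n R en (fun=> 0%N)) =
  \det (binom_mx R en (@stair n en)).
Proof.
move=> h1 h2 h3; rewrite Upsilon_word_sum.
have := iter_dd_op_monom R h1 h2 1%g (@admissible_stair n en).
rewrite -(perm_length_stair h1 h2 h3) (iter_dd_op_stair R h1 h2 h3) => e.
by rewrite mulrAC e mulrC mulKf // pnatr_eq0 -lt0n fact_gt0.
Qed.

(** * Layered permutations *)

Section LayerDeterminant.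
Variable R : realFieldType.

(** The matrix is a lower triangular matrix of coefficients times a Vandermonde matrix. *)
Lemma det_monic_poly q (P : nat -> {poly R}) (l y : nat -> R) :
  (forall i, P i \is monic) -> (forall i, size (P i) = i.+1) ->
  \det (\matrix_(i < q, j < q) (l i * (P i).[y j])) =
  \prod_(i < q) (l i * \prod_(j < i) (y i - y j)).
Proof.
move=> Pm Ps; pose L : 'M[R]_q := \matrix_(i, k) (l i * (P i)`_k).
pose a : 'rV[R]_q := \row_j y j.
have -> : \matrix_(i < q, j < q) (l i * (P i).[y j]) = L *m Vandermonde q a.
  apply/matrixP => i j; rewrite !mxE (@horner_coef_wide _ q) ?Ps // mulr_sumr.
  by apply: eq_bigr => k _; rewrite !mxE mulrA.
rewrite det_mulmx det_Vandermonde det_trig; last first.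
  by apply/is_trig_mxP => i j ij; rewrite mxE nth_default ?mulr0 ?Ps.
rewrite big_split /=; congr (_ * _).
  apply: eq_bigr => i _; rewrite mxE; have := Pm i.
  by rewrite monicE lead_coefE Ps /= => /eqP ->; rewrite mulr1.
rewrite (exchange_big_dep xpredT) //=; apply: eq_bigr => i _.
rewrite (big_ord_widen q (fun j => y i - y j)) ?(ltnW (ltn_ord i)) //.
by apply: eq_bigr => j _; rewrite !mxE.
Qed.

Definition layer_factor (p q : nat) : R :=
  \prod_(i < q) \prod_(j < i) ((2 * p + i + j.+1)%:R / (i + j.+1)%:R).

Lemma layer_factorS p q : layer_factor p q.+1 =
  layer_factor p q * \prod_(j < q) ((2 * p + q + j.+1)%:R / (q + j.+1)%:R).
Proof. exact: big_ord_recr. Qed.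

Lemma layer_factor_gt0 p q : 0 < layer_factor p q.
Proof.
apply: prodr_gt0 => i _; apply: prodr_gt0 => j _.
by rewrite divr_gt0 // ltr0n addnS.
Qed.

(** Pairing the factors [x - r] and [x + r + 1] makes this falling factorial a monic polynomial of
    degree [i] in [x * (x + 1)]. *)
Lemma bin_double_poly (x i : nat) :
  ('C(i + x, i.*2) * (i.*2)`!)%:R =
  \prod_(r < i) (x%:R * x.+1%:R - r%:R * r.+1%:R) :> R.
Proof.
rewrite bin_ffact; elim: i => [|i IH]; first by rewrite big_ord0 ffactn0.
rewrite big_ord_recr /= -IH doubleS addSn ffactnS /= ffactnSr.
have [le|lt] := ssrnat.leqP i x; last first.
  have -> : ((i + x) ^_ i.*2 = 0)%N by rewrite ffact_small //; lia.
  by rewrite mul0n muln0 mulr0n mul0r.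
have -> : (i + x - i.*2 = x - i)%N by lia.
rewrite !natrM natrB // -addSn natrD.
by rewrite -[i.+1%:R]natr1 -[x.+1%:R]natr1; ring.
Qed.

Lemma bin_poly (x i : nat) :
  ('C(x, i) * i`!)%:R = \prod_(r < i) (x%:R - r%:R) :> R.
Proof.
rewrite bin_ffact; elim: i => [|i IH]; first by rewrite big_ord0 ffactn0.
rewrite big_ord_recr /= -IH ffactnSr.
have [le|lt] := ssrnat.leqP i x; last by rewrite ffact_small ?mul0r.
by rewrite natrM natrB.
Qed.

Lemma fact_double i : ((i.*2)`! = i`! * \prod_(j < i) (i + j.+1))%N.
Proof.
rewrite -addnn; have le m : ((i + m)`! = i`! * \prod_(j < m) (i + j.+1))%N.
  elim: m => [|m IH]; first by rewrite big_ord0 addn0 muln1.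
  by rewrite big_ord_recr /= mulnA -IH addnS factS mulnC.
exact: le.
Qed.

(** Row [i] is a monic polynomial of degree [i], in [x * (x + 1)] on the left and in [x] on the
    right, with [x = p + j]. The quotient of the two Vandermonde products consists of the factors
    [2 * p + i + j + 1], and that of the factorials gives the denominators. *)
Lemma det_layer p q :
  \det (\matrix_(i < q, j < q) ('C(i + (p + j), i.*2))%:R) =
  layer_factor p q * \det (\matrix_(i < q, j < q) ('C(p + j, i))%:R) :> R
  /\ \det (\matrix_(i < q, j < q) ('C(p + j, i))%:R) != 0 :> R.
Proof.
have fn0 i : (i`!)%:R != 0 :> R by rewrite pnatr_eq0 -lt0n fact_gt0.
have -> : \matrix_(i < q, j < q) ('C(i + (p + j), i.*2))%:R =
    \matrix_(i < q, j < q) ((((i : nat).*2)`!)%:R^-1 *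
      (\prod_(r < i) ('X - (r%:R * r.+1%:R)%:P)).[(p + j)%:R * (p + j).+1%:R]) :> 'M[R]_q.
  apply/matrixP => i j; rewrite !mxE horner_prod.
  under [in RHS]eq_bigr do rewrite hornerXsubC.
  by rewrite -bin_double_poly natrM mulrCA mulVf // mulr1.
have -> : \matrix_(i < q, j < q) ('C(p + j, i))%:R =
    \matrix_(i < q, j < q) (((i : nat)`!)%:R^-1 *
      (\prod_(r < i) ('X - (r%:R)%:P)).[(p + j)%:R]) :> 'M[R]_q.
  apply/matrixP => i j; rewrite !mxE horner_prod.
  under [in RHS]eq_bigr do rewrite hornerXsubC.
  by rewrite -bin_poly natrM mulrCA mulVf // mulr1.
have sz (F : nat -> R) i : size (\prod_(r < i) ('X - (F r)%:P)) = i.+1.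
  rewrite size_prod_XsubC -(sum1_size (index_enum _)).
  by rewrite (eq_bigl (mem 'I_i)) // sum1_card card_ord.
have mo (F : nat -> R) i : \prod_(r < i) ('X - (F r)%:P) \is monic.
  exact: monic_prod_XsubC.
rewrite (@det_monic_poly q (fun i => \prod_(r < i) ('X - (r%:R * r.+1%:R)%:P))
  (fun i => ((i.*2)`!)%:R^-1) (fun j => (p + j)%:R * (p + j).+1%:R)) //; last first.
  by move=> i; apply: (sz (fun r => r%:R * r.+1%:R)).
  by move=> i; apply: (mo (fun r => r%:R * r.+1%:R)).
rewrite (@det_monic_poly q (fun i => \prod_(r < i) ('X - (r%:R)%:P))
  (fun i => (i`!)%:R^-1) (fun j => (p + j)%:R)) //.
split.
  rewrite /layer_factor -big_split /=; apply: eq_bigr => i _.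
  rewrite fact_double natrM invfM natr_prod mulrAC -mulrA [RHS]mulrCA; congr (_ * _).
  rewrite -prodfV -!big_split /=; apply: eq_bigr => j _.
  rewrite [RHS]mulrAC; congr (_ / _).
  have -> : (2 * p + i + j.+1 = (p + i) + (p + j).+1)%N by lia.
  rewrite [((p + i) + _)%:R]natrD -!natr1; ring.
apply/prodf_neq0 => i _; rewrite mulf_neq0 ?invr_neq0 //.
apply/prodf_neq0 => j _; rewrite subr_eq0 eqr_nat eqn_add2l.
by rewrite neq_ltn ltn_ord orbT.
Qed.

Fixpoint layered_value (b : seq nat) : R :=
  if b is q :: b' then layered_value b' * layer_factor (sumn b') q else 1.

Lemma layered_value_gt0 b : 0 < layered_value b.
Proof. by elim: b => //= q b IH; rewrite mulr_gt0 // layer_factor_gt0. Qed.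

End LayerDeterminant.

(** * Blocks and one-line notation of layered permutations *)

Section LayeredWords.

Fixpoint block_end (m : nat) (c : seq nat) (i : nat) : nat :=
  if c is p :: c' then if (i < m + p)%N then (m + p)%N else block_end (m + p) c' i
  else m.

Fixpoint block_start (m : nat) (c : seq nat) (i : nat) : nat :=
  if c is p :: c' then if (i < m + p)%N then m else block_start (m + p) c' i
  else m.

Lemma block_end_gt m c i : (i < m + sumn c)%N ->
  (i < block_end m c i <= m + sumn c)%N.
Proof.
elim: c m => [|p c IH] m /=; first by rewrite addn0; lia.
case: ifP => [lt _|_]; first by rewrite lt; lia.
by rewrite addnA; apply: IH.
Qed.

Lemma block_start_le m c i : (m <= i < m + sumn c)%N -> (m <= block_start m c i <= i)%N.
Proof.
elim: c m => [|p c IH] m /=; first by rewrite addn0; lia.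
case: ifP => [lt ?|ge]; first by lia.
by move=> h; have := IH (m + p)%N; lia.
Qed.

Lemma block_end_eq m c i j : (i <= j)%N -> (j < m + sumn c)%N ->
  (j < block_end m c i)%N -> block_end m c j = block_end m c i.
Proof.
elim: c m => [|p c IH] m //= ij.
have [lt _ ->//|ge js] := ssrnat.ltnP i (m + p).
have -> : (j < m + p)%N = false by lia.
by apply: IH; rewrite // -addnA.
Qed.

Lemma block_start_eq m c i j : (i <= j)%N -> (j < m + sumn c)%N ->
  block_end m c j = block_end m c i -> block_start m c j = block_start m c i.
Proof.
elim: c m => [|p c IH] m //= ij.
have [lt|ge] := ssrnat.ltnP i (m + p).
  case: ifP => // /negbT; rewrite -ssrnat.leqNgt => ge; rewrite addnA => js e.
  by have := block_end_gt js; rewrite e; lia.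
have -> : (j < m + p)%N = false by lia.
rewrite addnA; exact: IH.
Qed.

Lemma block_start_ge m c i j : (i <= j)%N -> (j < m + sumn c)%N ->
  block_end m c j != block_end m c i -> (block_end m c i <= block_start m c j)%N.
Proof.
elim: c m => [|p c IH] m /=; first by move=> ij _; rewrite eqxx.
move=> ij; rewrite addnA.
have [lt|ge] := ssrnat.ltnP i (m + p).
  case: ifP => [_ _ /eqP//|/negbT]; rewrite -ssrnat.leqNgt => ge js _.
  by have /andP[] := @block_start_le (m + p) c j ltac:(lia).
have -> : (j < m + p)%N = false by lia.
exact: IH.
Qed.

Lemma size_layered_word m c : size (layered_word m c) = sumn c.
Proof.
by elim: c m => //= p c IH m; rewrite size_cat size_rev size_iota IH.
Qed.

(** A decreasing block is the reflection of its interval of positions; start and end add up without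
    a correction because values start at 1 and positions at 0. *)
Lemma nth_layered_word m c i : (m <= i < m + sumn c)%N ->
  nth 0%N (layered_word m c) (i - m) = (block_start m c i + block_end m c i - i)%N.
Proof.
elim: c m => [|p c IH] m /=; first by rewrite addn0; lia.
move=> /andP[mi]; rewrite addnA => ip; rewrite nth_cat size_rev size_iota.
have -> : (i - m < p)%N = (i < m + p)%N by lia.
case: ifP => [lt|/negbT ge].
  rewrite nth_rev ?size_iota ?nth_iota; [lia|lia|lia].
by rewrite -IH; [congr (nth _ _ _); lia|lia].
Qed.

Definition layered_nth c i := (block_start 0 c i + block_end 0 c i - i)%N.

Lemma layered_nth_lt c i j : (i < j < sumn c)%N ->
  (layered_nth c j < layered_nth c i)%N = (block_end 0 c i == block_end 0 c j).
Proof.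
move=> /andP[ij js]; rewrite /layered_nth.
have le := ltnW ij; have := @block_end_gt 0 c i ltac:(lia); have := @block_end_gt 0 c j js.
have := @block_start_le 0 c i ltac:(lia); have := @block_start_le 0 c j ltac:(lia).
have [e|ne] := eqVneq (block_end 0 c j) (block_end 0 c i).
  by rewrite (@block_start_eq 0 _ _ _ le js e) e; lia.
have := @block_start_ge 0 _ _ _ le js ne; lia.
Qed.

Lemma layered_nth_bound c i : (i < sumn c)%N -> (0 < layered_nth c i <= sumn c)%N.
Proof.
move=> lt; rewrite /layered_nth.
have := @block_end_gt 0 c i lt; have := @block_start_le 0 c i lt; lia.
Qed.

Lemma one_lineE n (w : 'S_n) (i : 'I_n) : nth 0%N (one_line w) i = (w i).+1.
Proof.
by rewrite (nth_map i) ?size_enum_ord // nth_ord_enum.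
Qed.

Lemma is_layered_nth n b (w : 'S_n) : is_layered_of b w ->
  forall i : 'I_n, (w i).+1 = layered_nth (rev b) i.
Proof.
move=> /and3P[_ /eqP sn /eqP wE] i; rewrite -one_lineE wE /layered_nth.
have := @nth_layered_word 0 (rev b) i; rewrite subn0 => -> //.
by rewrite sumn_rev sn /=.
Qed.

Lemma is_layered_exists n b : all (leq 1) b -> sumn b = n ->
  exists w : 'S_n, is_layered_of b w.
Proof.
move=> b1 sn; pose c := rev b; have sc : sumn c = n by rewrite sumn_rev.
have lt (i : 'I_n) : ((layered_nth c i).-1 < n)%N.
  by have := @layered_nth_bound c i; rewrite sc => /(_ (ltn_ord i)); lia.
pose f (i : 'I_n) := Ordinal (lt i).
have f_lt (i j : 'I_n) : (i < j)%N -> f i != f j.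
  move=> ij; rewrite -val_eqE /=.
  have ne : layered_nth c i != layered_nth c j.
    have h : (i < j < sumn c)%N by rewrite ij sc /=.
    have := layered_nth_lt h; case: eqP => e; first by lia.
    move=> _; apply/eqP => ee.
    move: e; rewrite /layered_nth in ee.
    have := @block_end_gt 0 c i ltac:(lia); have := @block_end_gt 0 c j ltac:(lia).
    have := @block_start_le 0 c i ltac:(lia); have := @block_start_le 0 c j ltac:(lia).
    move=> h1 h2 h3 h4 /eqP e.
    by have := @block_start_ge 0 c i j ltac:(lia) ltac:(lia) ltac:(by rewrite eq_sym); lia.
  have := @layered_nth_bound c i; have := @layered_nth_bound c j; rewrite sc.
  by move=> /(_ (ltn_ord j)) h1 /(_ (ltn_ord i)) h2; lia.
have f_inj : injective f.
  move=> i j e; have [/f_lt|/f_lt|/ord_inj//] := ssrnat.ltngtP i j; by rewrite e eqxx.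
exists (perm f_inj); apply/and3P; split => //; first exact/eqP.
apply/eqP; apply: (@eq_from_nth _ 0%N).
  by rewrite size_layered_word -/c sc size_map size_enum_ord.
move=> i; rewrite size_map size_enum_ord => ilt.
rewrite (one_lineE _ (Ordinal ilt)) permE /=.
have := @layered_nth_bound c i; rewrite sc => /(_ ilt) h; rewrite prednK; last by lia.
by have := @nth_layered_word 0 c i; rewrite subn0 => -> //; rewrite sc.
Qed.

End LayeredWords.

(** * The product formula for layered permutations and the recursion for the maximum *)

Section UpsilonLayered.
Variable R : realType.

Definition num_mx n (e : nat -> nat) : 'M[R]_n :=
  \matrix_(i, j) (if e i == e j then 'C(e i - i.+1 + j, e i - i.+1 + e i - i.+1)%:R else 0).
Definition den_mx n (e : nat -> nat) : 'M[R]_n :=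
  \matrix_(i, j) (if e i == e j then 'C(j, e i - i.+1)%:R else 0).

Lemma block_end_rcons m c q i : (m <= i < m + sumn c)%N ->
  block_end m (rcons c q) i = block_end m c i.
Proof.
elim: c m => [|p c IH] m /=; first by rewrite addn0; lia.
by rewrite addnA => h; case: ssrnat.ltnP => // ge; rewrite IH // ge; case/andP: h.
Qed.

Lemma block_end_last m c q i : (m + sumn c <= i < m + sumn c + q)%N ->
  block_end m (rcons c q) i = (m + sumn c + q)%N.
Proof.
elim: c m => [|p c IH] m /=; first by rewrite addn0 => /andP[_ ->].
rewrite addnA => h; rewrite IH //.
by have -> : (i < m + p)%N = false by lia.
Qed.

Lemma det_rcons (T : nat -> nat -> R) (e : nat -> nat) p q :
  (forall i j, (i < p)%N -> (p <= j < p + q)%N -> e i != e j) ->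
  \det (\matrix_(i < p + q, j < p + q) (if e i == e j then T i j else 0)) =
  \det (\matrix_(i < p, j < p) (if e i == e j then T i j else 0)) *
  \det (\matrix_(i < q, j < q) (if e (p + i)%N == e (p + j)%N then T (p + i)%N (p + j)%N else 0)).
Proof.
move=> ne; set A := (X in \det X = _).
have ur0 : ursubmx A = 0.
  apply/matrixP => i j; rewrite !mxE /= ifN //; apply: ne; first exact: ltn_ord.
  by rewrite leq_addr ltn_add2l ltn_ord.
rewrite -{1}(submxK A) ur0 det_lblock.
by congr (_ * _); congr determinant; apply/matrixP => i j; rewrite !mxE.
Qed.

Lemma det_rev_rows q (A : 'M[R]_q) :
  \det (\matrix_(i, j) A (rev_ord i) j) = (-1) ^+ (perm (@rev_ord_inj q)) * \det A.
Proof.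
rewrite -det_perm -det_mulmx -row_permE; congr (\det _).
by apply/matrixP => i j; rewrite !mxE permE.
Qed.

(** In the last block, the exponent at [p + i] is [rev_ord i], so the rows are those of [det_layer]
    in reverse order. The sign of the reversal is the same in both determinants. *)
Lemma det_num_den b :
  \det (num_mx (sumn b) (block_end 0 (rev b))) =
    layered_value R b * \det (den_mx (sumn b) (block_end 0 (rev b))) /\
  \det (den_mx (sumn b) (block_end 0 (rev b))) != 0.
Proof.
elim: b => [|q b [IH1 IH2]]; first by rewrite /= !det_mx00 mul1r oner_neq0.
rewrite [sumn (q :: b)]addnC rev_cons; set e := block_end _ _.
set p := sumn b in IH1 IH2 *.
have sr : sumn (rev b) = p by rewrite sumn_rev.
have e_lt i : (i < p)%N -> e i = block_end 0 (rev b) i.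
  by move=> h; rewrite /e block_end_rcons // sr.
have e_ge i : (p <= i < p + q)%N -> e i = (p + q)%N.
  by move=> h; rewrite /e block_end_last ?sr.
have ne i j : (i < p)%N -> (p <= j < p + q)%N -> e i != e j.
  move=> ip jp; rewrite (e_ge _ jp) e_lt //.
  have := @block_end_gt 0 (rev b) i; rewrite add0n sr => /(_ ip); lia.
have numE : \det (num_mx (p + q) e) = \det (num_mx p (block_end 0 (rev b))) *
    \det (\matrix_(i < q, j < q) ('C((rev_ord i) + (p + j), (rev_ord i).*2))%:R).
  rewrite /num_mx (@det_rcons (fun i j => 'C(e i - i.+1 + j, e i - i.+1 + e i - i.+1)%:R)) //.
  congr (_ * _); congr determinant.
    by apply/matrixP => i j; rewrite !mxE !e_lt.
  apply/matrixP => i j; rewrite !mxE !e_ge ?eqxx; try by rewrite leq_addr ltn_add2l ltn_ord.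
  by congr ('C(_, _)%:R) => /=; have := ltn_ord i; lia.
have denE : \det (den_mx (p + q) e) = \det (den_mx p (block_end 0 (rev b))) *
    \det (\matrix_(i < q, j < q) ('C(p + j, rev_ord i))%:R).
  rewrite /den_mx (@det_rcons (fun i j => 'C(j, e i - i.+1)%:R)) //.
  congr (_ * _); congr determinant.
    by apply/matrixP => i j; rewrite !mxE !e_lt.
  apply/matrixP => i j; rewrite !mxE !e_ge ?eqxx; try by rewrite leq_addr ltn_add2l ltn_ord.
  by congr ('C(_, _)%:R) => /=; have := ltn_ord i; lia.
pose N1 : 'M[R]_q := \matrix_(i, j) ('C(i + (p + j), i.*2))%:R.
pose N0 : 'M[R]_q := \matrix_(i, j) ('C(p + j, i))%:R.
have {}numE : \det (num_mx (p + q) e) = \det (num_mx p (block_end 0 (rev b))) *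
    ((-1) ^+ (perm (@rev_ord_inj q)) * \det N1).
  by rewrite numE -det_rev_rows; congr (_ * \det _); apply/matrixP => i j; rewrite !mxE.
have {}denE : \det (den_mx (p + q) e) = \det (den_mx p (block_end 0 (rev b))) *
    ((-1) ^+ (perm (@rev_ord_inj q)) * \det N0).
  by rewrite denE -det_rev_rows; congr (_ * \det _); apply/matrixP => i j; rewrite !mxE.
have [N1E N0n] := det_layer R p q.
have alg (x1 x2 x3 x4 x5 : R) : x1 * x2 * (x5 * (x3 * x4)) = x1 * x3 * (x2 * (x5 * x4)).
  by ring.
rewrite numE denE IH1 N1E alg; split => //.
by rewrite !mulf_neq0 // signr_eq0.
Qed.

Lemma Upsilon_layered n b (w : 'S_n) : is_layered_of b w -> Upsilon R w = layered_value R b.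
Proof.
move=> bw; have wE := is_layered_nth bw; move/and3P: bw => [_ /eqP sn _].
pose e := block_end 0 (rev b); have sr : sumn (rev b) = n by rewrite sumn_rev.
have h1 i : (i < n)%N -> (i < e i <= n)%N.
  by move=> h; have := @block_end_gt 0 (rev b) i; rewrite add0n sr; apply.
have h2 i j : (j < n)%N -> (i <= j)%N -> (j < e i)%N -> e j = e i.
  by move=> jn ij; apply: block_end_eq => //; rewrite sr.
have h3 (i j : 'I_n) : (i < j)%N -> (w j < w i)%N = (e i == e j).
  by move=> ij; rewrite -ltnS !wE layered_nth_lt // ij sr /=.
have := Upsilon_det R h1 h2 h3; have [] := det_num_den b; rewrite sn -/e.
have -> : num_mx n e = binom_mx R e (@stair n e) by apply/matrixP => i j; rewrite !mxE.
have -> : den_mx n e = @binom_mx n R e (fun=> 0%N) by apply/matrixP => i j; rewrite !mxE.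
by move=> -> nz /(mulIf nz).
Qed.

Lemma max_layered_ge n b : all (leq 1) b -> sumn b = n ->
  layered_value R b <= max_layered R n.
Proof.
move=> b1 sn; have [w bw] := is_layered_exists b1 sn.
rewrite -(Upsilon_layered bw) /max_layered; apply: le_bigmax_cond.
by apply/asboolP; exists b.
Qed.

Lemma Upsilon_ge0 n (w : 'S_n) : 0 <= Upsilon R w.
Proof. by rewrite /Upsilon divr_ge0. Qed.

Lemma max_layered_attained n : exists b (w : 'S_n),
  is_layered_of b w /\ Upsilon R w = max_layered R n.
Proof.
have b1 : all (leq 1) (nseq n 1%N) by rewrite all_nseq orbT.
have sn : sumn (nseq n 1%N) = n by rewrite sumn_nseq mul1n.
have [w0 w0n] := is_layered_exists b1 sn.
have P0 : `[< layered w0 >] by apply/asboolP; exists (nseq n 1%N).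
have [w Pw wE] := @eq_bigmax _ R _ 0 w0 (fun w : 'S_n => `[< layered w >]) _ P0
  (fun w (_ : `[< layered w >]) => Upsilon_ge0 w).
have /asboolP[b bw] : `[< layered w >] by [].
by exists b, w; split.
Qed.

Definition optimal n b :=
  [/\ all (leq 1) b, sumn b = n & layered_value R b = max_layered R n].

Lemma is_layered_optimal n b (w : 'S_n) :
  is_layered_of b w -> Upsilon R w = max_layered R n -> optimal n b.
Proof.
move=> bw e; have /and3P[b1 /eqP sn _] := bw.
by split => //; rewrite -(Upsilon_layered bw).
Qed.

Lemma optimal_exists n : exists b, optimal n b.
Proof.
have [b [w [bw wE]]] := max_layered_attained n; exists b.
exact: is_layered_optimal bw wE.
Qed.

(** The factor of the last layer [q] depends only on [q] and the total size of the others, so a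
    better [b] would improve the whole. *)
Lemma optimal_cons n q b : optimal n (q :: b) ->
  [/\ (0 < q <= n)%N, optimal (n - q) b &
      max_layered R n = max_layered R (n - q) * layer_factor R (n - q) q].
Proof.
case=> /= /andP[q1 b1] sn vE; subst n; rewrite addKn.
have bE : layered_value R b = max_layered R (sumn b).
  apply/eqP; rewrite eq_le max_layered_ge //=.
  have [b' [b'1 sb' <-]] := optimal_exists (sumn b).
  have := @max_layered_ge (q + sumn b) (q :: b'); rewrite /= q1 b'1 sb'.
  by move=> /(_ isT erefl); rewrite -vE ler_pM2r // layer_factor_gt0.
by split; rewrite ?q1 ?leq_addr // -vE bE.
Qed.

Lemma max_layered_cons p q : (0 < q)%N ->
  max_layered R p * layer_factor R p q <= max_layered R (p + q).
Proof.
move=> q0; have [b [b1 <- <-]] := optimal_exists p.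
by have := @max_layered_ge (sumn b + q) (q :: b); rewrite /= q0 b1 addnC; apply.
Qed.

Lemma max_layered_gt0 n : 0 < max_layered R n.
Proof. by have [b [_ _ <-]] := optimal_exists n; apply: layered_value_gt0. Qed.

End UpsilonLayered.

(** * The function f *)

Section Calculus.
Local Open Scope classical_set_scope.
Variable R : realType.
Implicit Types (f g : R -> R) (x c d : R).

Local Notation isd x f d := (is_derive (x : R) (1 : R) (f : R -> R) (d : R)).
Local Notation cont x f := (continuous_at (x : R) (f : R -> R)).

Lemma isd_eq x f d d' : isd x f d -> d = d' -> isd x f d'.
Proof. by move=> h <-. Qed.

Lemma isd_cst x c : isd x (fun=> c) 0.
Proof. exact: is_derive_cst. Qed.

Lemma isd_id x : isd x (fun t => t) 1.
Proof. exact: is_derive_id. Qed.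

Lemma isd_add x f g c d : isd x f c -> isd x g d -> isd x (fun t => f t + g t) (c + d).
Proof. by move=> *; apply: is_deriveD. Qed.

Lemma isd_opp x f c : isd x f c -> isd x (fun t => - f t) (- c).
Proof. by move=> *; apply: is_deriveN. Qed.

Lemma isd_mul x f g c d : isd x f c -> isd x g d ->
  isd x (fun t => f t * g t) (f x * d + g x * c).
Proof. by move=> *; apply: is_deriveM. Qed.

Lemma isd_sqr x f c : isd x f c -> isd x (fun t => f t ^+ 2) (2 * f x * c).
Proof.
move=> fc; have := isd_mul fc fc; rewrite (_ : (fun t => f t * f t) = fun t => f t ^+ 2).
  by move/isd_eq; apply; ring.
by apply/funext => t; rewrite expr2.
Qed.

Lemma isd_comp x f g c d : isd x g d -> isd (g x) f c -> isd x (fun t => f (g t)) (c * d).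
Proof.
by move=> gd fc; have := @is_derive1_comp R f g x c d fc gd.
Qed.

Lemma isd_ln x f c : 0 < f x -> isd x f c -> isd x (fun t => ln (f t)) (c / f x).
Proof.
move=> fx fc; apply: isd_eq (isd_comp fc (is_derive1_ln fx)) _.
by rewrite mulrC.
Qed.

Lemma isd_continuous x f c : isd x f c -> cont x f.
Proof.
by move=> fc; apply: differentiable_continuous; apply/derivable1_diffP; apply: ex_derive.
Qed.

(** Unlike [ln], this is continuous at 0, which makes the formulas below usable at the ends of their
    intervals. *)
Definition xlnx x := x * ln x.

Lemma isd_xlnx x f c : 0 < f x -> isd x f c ->
  isd x (fun t => xlnx (f t)) (c * (ln (f x) + 1)).
Proof.
move=> fx fc; apply: isd_eq (isd_mul fc (isd_ln fx fc)) _.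
by field; rewrite gt_eqF.
Qed.

(** With [s] the square root of [x], the bound reduces to [ln s^-1 <= s^-1]. *)
Lemma xlnx_bound x : 0 < x <= 1 -> `|xlnx x| <= 2 * Num.sqrt x.
Proof.
move=> /andP[x0 x1]; pose s := Num.sqrt x.
have s0 : 0 < s by rewrite sqrtr_gt0.
have xE : x = s * s by rewrite -expr2 sqr_sqrtr // ltW.
have lnE : ln x = - (2 * ln s^-1).
  by rewrite {1}xE lnM ?posrE // lnV ?posrE //; ring.
have lns : ln s^-1 <= s^-1 by apply/ltW/ln_sublinear; rewrite invr_gt0.
rewrite ler0_norm; last by rewrite mulr_ge0_le0 ?ln_le0 // ltW.
rewrite /xlnx lnE mulrN opprK -/s.
have -> : x * (2 * ln s^-1) = 2 * s * (s * ln s^-1) by rewrite {1}xE; ring.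
rewrite -[leRHS]mulr1 ler_pM2l ?mulr_gt0 //.
by rewrite -(mulfV (lt0r_neq0 s0)) ler_pM2l.
Qed.

Lemma continuous_xlnx x : 0 <= x -> cont x xlnx.
Proof.
rewrite le_eqVlt => /orP[/eqP <-|x0]; last first.
  by apply: isd_continuous (isd_xlnx _ (isd_id x)).
rewrite /continuous_at {2}/xlnx mul0r; apply/(@cvgrPdist_le _ R^o) => e e0.
have d0 : 0 < Num.min 1 ((e / 2) ^+ 2) by rewrite lt_min ltr01 exprn_gt0 ?divr_gt0.
near=> t; rewrite sub0r normrN; have [t0|t0] := lerP t 0.
  by rewrite /xlnx ln0 // mulr0 normr0 ltW.
have : `|t| < Num.min 1 ((e / 2) ^+ 2).
  by near: t; exists (Num.min 1 ((e / 2) ^+ 2)) => // y /=; rewrite sub0r normrN.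
rewrite lt_min gtr0_norm // => /andP[t1 te].
apply: le_trans (xlnx_bound _) _; first by rewrite t0 ltW.
have -> : e = 2 * Num.sqrt ((e / 2) ^+ 2).
  by rewrite sqrtr_sqr ger0_norm ?divr_ge0 ?ltW //; field.
by rewrite ler_pM2l // ler_wsqrtr // ltW.
Unshelve. all: by end_near.
Qed.

Lemma cont_comp x f g : cont x g -> cont (g x) f -> cont x (fun t => f (g t)).
Proof. by move=> gx fx; apply: continuous_comp. Qed.

Lemma cont_add x f g : cont x f -> cont x g -> cont x (fun t => f t + g t).
Proof. by move=> *; apply: continuousD. Qed.

Lemma cont_mul x f g : cont x f -> cont x g -> cont x (fun t => f t * g t).
Proof. by move=> *; apply: continuousM. Qed.

Lemma cont_opp x f : cont x f -> cont x (fun t => - f t).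
Proof. by move=> *; apply: continuousN. Qed.

Lemma cont_cst x c : cont x (fun=> c).
Proof. exact: cst_continuous. Qed.

Lemma cont_id x : cont x (fun t => t).
Proof. by move=> ?. Qed.

Lemma cont_sqr x f : cont x f -> cont x (fun t => f t ^+ 2).
Proof.
move=> fx; rewrite (_ : (fun t => _) = fun t => f t * f t); first exact: cont_mul.
by apply/funext => t; rewrite expr2.
Qed.

Lemma cont_xlnx x f : 0 <= f x -> cont x f -> cont x (fun t => xlnx (f t)).
Proof. by move=> fx cf; apply: cont_comp cf _; apply: continuous_xlnx. Qed.

Lemma cont_ln x f : 0 < f x -> cont x f -> cont x (fun t => ln (f t)).
Proof. by move=> fx cf; apply: cont_comp cf _; apply: continuous_ln. Qed.

Lemma mean_value f (df : R -> R) (a b : R) : a < b ->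
  (forall x, a < x < b -> isd x f (df x)) ->
  (forall x, a <= x <= b -> cont x f) ->
  exists c, a < c < b /\ f b - f a = df c * (b - a).
Proof.
move=> ab fd fc.
have fw : {within `[a, b], continuous f}.
  by apply: continuous_in_subspaceT => x; rewrite inE /= ?in_itv /=; apply: fc.
have fd' x : x \in `]a, b[%R -> isd x f (df x) by rewrite in_itv /=; apply: fd.
have [c cab e] := MVT ab fd' fw; exists c; split => //; move: cab; rewrite in_itv.
Qed.

Lemma intermediate_value f (a b : R) : a < b -> (forall x, a <= x <= b -> cont x f) ->
  f a * f b <= 0 -> exists2 c, a <= c <= b & f c = 0.
Proof.
move=> ab fc fab.
have fw : {within `[a, b], continuous f}.
  by apply: continuous_in_subspaceT => x; rewrite inE /= ?in_itv /=; apply: fc.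
have [|c] := @IVT R f a b 0 (ltW ab) fw; last by rewrite in_itv /=; exists c.
rewrite ge_min le_max; have [fa|fa] := lerP (f a) 0 => /=.
  by have [//|fb] := lerP 0 (f b); nra.
by have [//|fb] := lerP (f b) 0; nra.
Qed.

End Calculus.

Ltac isd_tac := repeat (first [ exact: isd_cst | exact: isd_id
  | eapply isd_add | eapply isd_opp | eapply isd_sqr | eapply isd_mul
  | eapply isd_ln | eapply isd_xlnx ]).
Ltac neq0_tac := repeat (apply/andP; split); apply: lt0r_neq0; lra.
Ltac cont_tac := repeat lazymatch goal with
  | |- continuous_at _ (fun _ => ?c) => exact: cont_cst
  | |- continuous_at _ (fun t => t) => exact: cont_id
  | |- continuous_at _ (fun t => @?f t + @?g t) => apply: (@cont_add _ _ f g)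
  | |- continuous_at _ (fun t => - (@?f t)) => apply: (@cont_opp _ _ f)
  | |- continuous_at _ (fun t => xlnx (@?f t)) => apply: (@cont_xlnx _ _ f)
  | |- continuous_at _ (fun t => ln (@?f t)) => apply: (@cont_ln _ _ f)
  | |- continuous_at _ (fun t => @?f t ^+ 2) => apply: (@cont_sqr _ _ f)
  | |- continuous_at _ (fun t => @?f t * @?g t) => apply: (@cont_mul _ _ f g)
  end.

(** * The critical equation and the uniqueness of its solution *)

Section Profile.
Variable R : realType.
Implicit Types (x y : R).
Local Notation isd x f d := (is_derive (x : R) (1 : R) (f : R -> R) (d : R)).
Local Notation cont x f := (continuous_at (x : R) (f : R -> R)).

Definition profile_deriv x : R :=
  2 * xlnx x + xlnx (1 - x) - xlnx (1 + x) + 2 * ln 2.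

Lemma isd_profile x : 0 < x < 1 -> isd x (@layered_f R) (profile_deriv x).
Proof.
move=> /andP[x0 x1]; rewrite /layered_f; eapply isd_eq; first by isd_tac; lra.
by rewrite /profile_deriv /xlnx; field; neq0_tac.
Qed.

Lemma cont_profile x : 0 < x < 1 -> cont x (@layered_f R).
Proof. by move=> x01; apply: isd_continuous (isd_profile x01). Qed.

(** The left-hand side of the equation for alpha, expanded; it is also the numerator of the
    derivative of [ratio]. *)
Definition crit x : R :=
  2 * xlnx x + (1 - x) * xlnx (1 - x) - (1 + x) * xlnx (1 + x) + 2 * (1 + x ^+ 2) * ln 2.

Lemma critE x : 2 * x * layered_f x + (1 - x ^+ 2) * profile_deriv x = crit x.
Proof. by rewrite /layered_f /profile_deriv /crit /xlnx; field. Qed.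

Lemma critical_alphaE x : critical_alpha x <-> 0 < x < 1 /\ crit x = 0.
Proof.
rewrite /critical_alpha; split=> -[x01]; have d := isd_profile x01;
  by rewrite derive1E derive_val critE.
Qed.

Definition crit1 x : R :=
  2 * ln x - 2 * xlnx (1 - x) - 2 * xlnx (1 + x) + 4 * x * ln 2.
Definition crit2 x : R := 2 * x^-1 + 2 * ln (1 - x) - 2 * ln (1 + x) + 4 * ln 2.

Lemma isd_crit x : 0 < x < 1 -> isd x crit (crit1 x).
Proof.
move=> /andP[x0 x1]; rewrite /crit; eapply isd_eq; first by isd_tac; lra.
by rewrite /crit1 /xlnx; field; neq0_tac.
Qed.

Lemma isd_crit1 x : 0 < x < 1 -> isd x crit1 (crit2 x).
Proof.
move=> /andP[x0 x1]; rewrite /crit1; eapply isd_eq; first by isd_tac; lra.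
by rewrite /crit2 /xlnx; field; neq0_tac.
Qed.

Lemma cont_crit x : 0 < x <= 1 -> cont x crit.
Proof. by move=> /andP[x0 x1]; rewrite /crit; cont_tac; lra. Qed.

Lemma cont_crit1 x : 0 < x <= 1 -> cont x crit1.
Proof. by move=> /andP[x0 x1]; rewrite /crit1; cont_tac; lra. Qed.

Lemma crit_one : crit 1 = 0.
Proof. by rewrite /crit /xlnx ln1 subrr; rewrite (_ : 1 + 1 = 2 :> R) //; ring. Qed.

Lemma crit1_one : crit1 1 = 0.
Proof.
rewrite /crit1 /xlnx ln1 subrr ln0 //; rewrite (_ : 1 + 1 = 2 :> R) //; ring.
Qed.

Lemma crit2_decr x y : 0 < x -> x < y -> y < 1 -> crit2 y < crit2 x.
Proof.
move=> x0 xy y1; rewrite /crit2.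
have : y^-1 < x^-1 by rewrite ltf_pV2 ?posrE //; lra.
have : ln (1 - y) < ln (1 - x) by rewrite ltr_ln ?posrE; lra.
have : ln (1 + x) < ln (1 + y) by rewrite ltr_ln ?posrE; lra.
lra.
Qed.

Lemma rolle_crit (f df : R -> R) x y : 0 < x -> x < y -> y <= 1 ->
  (forall t, 0 < t < 1 -> isd t f (df t)) -> (forall t, 0 < t <= 1 -> cont t f) ->
  f x = f y -> exists c, x < c < y /\ df c = 0.
Proof.
move=> x0 xy y1 fd fc fxy.
have [|| c [cxy e]] := @mean_value R f df x y xy.
- by move=> t /andP[? ?]; apply: fd; lra.
- by move=> t /andP[? ?]; apply: fc; lra.
exists c; split => //; move: e; rewrite fxy subrr => /esym/eqP.
by rewrite mulf_eq0 subr_eq0 (gt_eqF xy) orbF => /eqP.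
Qed.

(* A second zero would give crit, crit1 and crit2 at least three, three and two
   zeros on ]0, 1], counting the zero at 1 of the first two. *)
Lemma crit_zero_unique x y : 0 < x < 1 -> 0 < y < 1 -> crit x = 0 -> crit y = 0 -> x = y.
Proof.
wlog xy : x y / x <= y.
  move=> h x01 y01 hx hy; have [le|lt] := lerP x y; first exact: h.
  by apply/esym; apply: h => //; apply: ltW.
move=> /andP[x0 x1] /andP[y0 y1] hx hy; move: xy; rewrite le_eqVlt => /orP[/eqP//|xy].
have [|c [/andP[c1 c2] hc]] := @rolle_crit crit crit1 x y x0 xy (ltW y1) isd_crit cont_crit.
  by rewrite hx hy.
have [|d [/andP[d1 d2] hd]] := @rolle_crit crit crit1 y 1 y0 y1 (lexx _) isd_crit cont_crit.
  by rewrite hy crit_one.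
have c0 : 0 < c by lra.
have d0 : 0 < d by lra.
have cd : c < d by lra.
have [|p [/andP[p1 p2] hp]] := @rolle_crit crit1 crit2 c d c0 cd (ltW d2) isd_crit1 cont_crit1.
  by rewrite hc hd.
have [|q [/andP[q1 q2] hq]] := @rolle_crit crit1 crit2 d 1 d0 d2 (lexx _) isd_crit1 cont_crit1.
  by rewrite hd crit1_one.
have := @crit2_decr p q; rewrite hp hq ltxx; move=> /(_ ltac:(lra) ltac:(lra) ltac:(lra)) //.
Qed.

End Profile.

(** * The maximum of [ratio] at alpha and the loss away from it *)

Section Loss.
Variable R : realType.
Implicit Types (x y : R).
Local Notation isd x f d := (is_derive (x : R) (1 : R) (f : R -> R) (d : R)).
Local Notation cont x f := (continuous_at (x : R) (f : R -> R)).

Lemma cont_eps x f : cont x f -> forall e : R, 0 < e ->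
  exists2 d : R, 0 < d & forall t, `|t - x| < d -> `|f t - f x| < e.
Proof.
move=> fx e e0; have /(@cvgrPdist_lt _ R^o)/(_ e e0) := fx.
move=> /nbhs_ballP[d d0 h]; exists d => // t tx.
by rewrite distrC; apply: h; rewrite /ball /= distrC.
Qed.

Lemma isd_inv x (f : R -> R) c : f x != 0 -> isd x f c ->
  isd x (fun t => (f t)^-1) (- c / f x ^+ 2).
Proof.
move=> fx fc; have := @is_deriveV R f x c 1 fx fc.
move=> h; apply: isd_eq h _.
by rewrite /GRing.scale /=; field.
Qed.

Variable alpha : R.
Hypotheses (alpha01 : 0 < alpha < 1) (crit_alpha : crit alpha = 0).
Variables (xl xr : R).
Hypotheses (xl_bounds : 0 < xl < alpha) (xr_bounds : alpha < xr < 1).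
Hypotheses (crit_xl : 0 < crit xl) (crit_xr : crit xr < 0).

(** A change of sign produces a zero of [crit], which can only be [alpha]. The test points [xl] and
    [xr] then fix the sign on either side. *)
Lemma crit_sign x y : 0 < x -> x < y -> y < 1 -> crit x * crit y <= 0 ->
  x <= alpha <= y.
Proof.
move=> x0 xy y1 h; have [|c /andP[c1 c2] c0] := @intermediate_value R (@crit R) x y xy _ h.
  by move=> t /andP[t1 t2]; apply: cont_crit; lra.
have [a0 a1] := andP alpha01.
by rewrite (@crit_zero_unique R alpha c) //; lra.
Qed.

Lemma crit_gt0 x : 0 < x < alpha -> 0 < crit x.
Proof.
move=> /andP[x0 xa]; rewrite ltNge; apply/negP => cx.
have [l0 la] := andP xl_bounds; have [a0 a1] := andP alpha01.
have [xxl|xxl|e] := ltgtP x xl; last by move: crit_xl; rewrite -e ltNge cx.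
  by have := @crit_sign x xl x0 xxl (lt_trans la a1) (mulr_le0_ge0 cx (ltW crit_xl)); lra.
by have := @crit_sign xl x l0 xxl ltac:(lra) (mulr_ge0_le0 (ltW crit_xl) cx); lra.
Qed.

Lemma crit_lt0 x : alpha < x < 1 -> crit x < 0.
Proof.
move=> /andP[ax x1]; rewrite ltNge; apply/negP => cx.
have [ar r1] := andP xr_bounds; have [a0 a1] := andP alpha01.
have [xxr|xxr|e] := ltgtP x xr; last by move: crit_xr; rewrite -e ltNge cx.
  by have := @crit_sign x xr ltac:(lra) xxr r1 (mulr_ge0_le0 cx (ltW crit_xr)); lra.
by have := @crit_sign xr x ltac:(lra) xxr x1 (mulr_le0_ge0 (ltW crit_xr) cx); lra.
Qed.

Definition ratio x : R := layered_f x / (1 - x ^+ 2).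

Lemma isd_ratio x : 0 < x < 1 -> isd x ratio (crit x / (1 - x ^+ 2) ^+ 2).
Proof.
move=> x01; have [x0 x1] := andP x01.
have n0 : 1 - x ^+ 2 != 0 by apply: lt0r_neq0; nra.
have dv : isd x (fun t => 1 - t ^+ 2) (- (2 * x)).
  by eapply isd_eq; [isd_tac|rewrite /=; ring].
have h : isd x ratio _ := isd_mul (isd_profile x01) (@isd_inv x (fun t => 1 - t ^+ 2) _ n0 dv).
apply: isd_eq h _.
by rewrite -critE; field.
Qed.

Lemma cont_ratio x : 0 < x < 1 -> cont x ratio.
Proof. by move=> x01; apply: isd_continuous (isd_ratio x01). Qed.

Lemma ratio_mean x y : 0 < x -> x < y -> y < 1 -> exists c, x < c < y /\
  ratio y - ratio x = crit c / (1 - c ^+ 2) ^+ 2 * (y - x).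
Proof.
move=> x0 xy y1; apply: mean_value => // t /andP[t1 t2].
  by apply: isd_ratio; lra.
by apply: cont_ratio; lra.
Qed.

Lemma ratio_incr x y : 0 < x -> x < y -> y <= alpha -> ratio x < ratio y.
Proof.
move=> x0 xy ya; have [a0 a1] := andP alpha01.
have [c [/andP[c1 c2] e]] := ratio_mean x0 xy (le_lt_trans ya a1).
rewrite -subr_gt0 e mulr_gt0 ?subr_gt0 // divr_gt0 ?crit_gt0 ?exprn_gt0 //; nra.
Qed.

Lemma ratio_decr x y : alpha <= x -> x < y -> y < 1 -> ratio y < ratio x.
Proof.
move=> ax xy y1; have [a0 a1] := andP alpha01.
have [c [/andP[c1 c2] e]] := ratio_mean (lt_le_trans a0 ax) xy y1.
rewrite -subr_lt0 e nmulr_rlt0 ?subr_gt0 // pmulr_llt0 ?crit_lt0 ?invr_gt0 ?exprn_gt0 //; nra.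
Qed.

(** In units of the squared total size, what a last layer contributes too little when the proportion
    [x] remains on its left. *)
Definition loss x : R := ratio alpha * (1 - x ^+ 2) - layered_f x.

Lemma lossE x : 0 < x < 1 -> loss x = (1 - x ^+ 2) * (ratio alpha - ratio x).
Proof.
move=> /andP[x0 x1]; rewrite /loss /ratio; field.
have [a0 a1] := andP alpha01.
by apply/andP; split; apply: lt0r_neq0; nra.
Qed.

Lemma loss_ge0 x : 0 < x < 1 -> 0 <= loss x.
Proof.
move=> x01; have [x0 x1] := andP x01; rewrite lossE //.
have : ratio x <= ratio alpha.
  have [lt|gt|->//] := ltgtP x alpha; first by apply/ltW/ratio_incr.
  by apply/ltW/ratio_decr.
by move=> h; rewrite mulr_ge0 ?subr_ge0 //; nra.
Qed.

(** The bound is linear in [1 - x], the proportion of the last layer, so that the cost of successive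
    small layers adds up to their total size. *)
Lemma loss_right x0 : alpha < x0 < 1 -> exists2 c : R, 0 < c &
  forall x, x0 <= x < 1 -> c * (1 - x) <= loss x.
Proof.
move=> /andP[ax x01]; exists (ratio alpha - ratio x0).
  by rewrite subr_gt0 ratio_decr.
have [a0 a1] := andP alpha01; have := ratio_decr (lexx _) ax x01.
move=> r0 x /andP[xx x1]; rewrite lossE; last by lra.
have : ratio x <= ratio x0.
  by move: xx; rewrite le_eqVlt => /orP[/eqP ->//|lt]; apply/ltW/ratio_decr; lra.
move=> h; rewrite mulrC; apply: ler_pM; try lra.
by nra.
Qed.

Lemma loss_left x1 : 0 < x1 < alpha -> exists2 c : R, 0 < c &
  forall x, 0 < x <= x1 -> c <= loss x.
Proof.
move=> /andP[x10 x1a]; have [a0 a1] := andP alpha01.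
have r1 := ratio_incr x10 x1a (lexx _).
exists ((1 - x1 ^+ 2) * (ratio alpha - ratio x1)); first by rewrite mulr_gt0; nra.
move=> x /andP[x0 xx]; rewrite lossE; last by lra.
have : ratio x <= ratio x1.
  by move: xx; rewrite le_eqVlt => /orP[/eqP ->//|lt]; apply/ltW/ratio_incr; lra.
by move=> h; apply: ler_pM; nra.
Qed.

Lemma profile_one : layered_f (1 : R) = 0.
Proof. by rewrite /layered_f ln1 subrr (_ : 1 + 1 = 2 :> R) //; field. Qed.

Lemma cont_profile_one : cont 1 (@layered_f R).
Proof.
rewrite (_ : @layered_f R = fun x => x * xlnx x - 2^-1 * ((1 - x) * xlnx (1 - x))
    - 2^-1 * ((1 + x) * xlnx (1 + x)) + 2 * x * ln 2); last first.
  by apply/funext => x; rewrite /layered_f /xlnx; ring.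
by cont_tac; lra.
Qed.

(** Both [layered_f] and its derivative vanish at 1, so a layer of small proportion [b] contributes
    less than any multiple of [b]. *)
Lemma profile_near_one (c : R) : 0 < c -> exists2 b0 : R, 0 < b0 <= 1 / 2 &
  forall b, 0 < b < b0 -> layered_f (1 - b) <= c * b.
Proof.
move=> c0.
have c1 : cont 1 (@profile_deriv R) by rewrite /profile_deriv; cont_tac; lra.
have p1 : profile_deriv (1 : R) = 0.
  by rewrite /profile_deriv /xlnx ln1 subrr (_ : 1 + 1 = 2 :> R) //; ring.
have [d d0 h] := cont_eps c1 c0.
exists (Num.min d (1 / 2)).
  by rewrite lt_min d0 ge_min lexx orbT andbT; lra.
move=> b; rewrite lt_min => /and3P[b0 bd b2].
have [|||t [/andP[t1 t2] e]] := @mean_value R (@layered_f R) (@profile_deriv R) (1 - b) 1.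
- by lra.
- by move=> x /andP[? ?]; apply: isd_profile; lra.
- move=> x /andP[? ]; rewrite le_eqVlt => /orP[/eqP ->|?]; first exact: cont_profile_one.
  by apply: cont_profile; lra.
have : `|t - 1| < d by rewrite ltr0_norm; lra.
move=> /h; rewrite p1 subr0 ltr_norml => /andP[g1 g2].
move: e; rewrite profile_one; nra.
Qed.

End Loss.

(** * Asymptotics of the contribution of a layer *)

Section LayerAsymptotics.
Variable R : realType.
Local Notation isd x f d := (is_derive (x : R) (1 : R) (f : R -> R) (d : R)).
Local Notation cont x f := (continuous_at (x : R) (f : R -> R)).

Definition log_layer (a b : nat) : R := ln (layer_factor R a b).

Definition log_step (a t : R) : R := ln (t + 2 * a) - ln t.

Lemma log_layerS a b : log_layer a b.+1 =
  log_layer a b + \sum_(j < b) log_step a%:R (b + j.+1)%:R.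
Proof.
rewrite /log_layer layer_factorS.
have t0 j : 0 < (2 * a + b + j.+1)%:R / (b + j.+1)%:R :> R.
  by rewrite divr_gt0 // ltr0n addnS.
have lnp m : ln (\prod_(j < m) ((2 * a + b + j.+1)%:R / (b + j.+1)%:R)) =
    \sum_(j < m) log_step a%:R (b + j.+1)%:R :> R.
  elim: m => [|m IH]; first by rewrite !big_ord0 ln1.
  rewrite !big_ord_recr /= lnM ?posrE ?t0 ?prodr_gt0 // IH; congr (_ + _).
  rewrite ln_div ?posrE ?ltr0n ?addnS // /log_step; congr (ln _ - _).
  by rewrite -addnS -natrM -natrD; congr (_%:R); lia.
by rewrite lnM ?posrE ?layer_factor_gt0 ?prodr_gt0 // lnp.
Qed.

Lemma log_layer0l b : log_layer 0 b = 0.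
Proof.
rewrite /log_layer /layer_factor big1 ?ln1 // => i _; apply: big1 => j _.
by rewrite muln0 add0n divff // pnatr_eq0 addnS.
Qed.

Lemma log_layer0r a : log_layer a 0 = 0.
Proof. by rewrite /log_layer /layer_factor big_ord0 ln1. Qed.

Lemma log_layer_mono a b : log_layer a b <= log_layer a.+1 b.
Proof.
rewrite /log_layer ler_ln ?posrE ?layer_factor_gt0 //.
apply: ler_prod => i _; apply/andP; split.
  by apply: prodr_ge0 => j _; rewrite divr_ge0.
apply: ler_prod => j _; rewrite divr_ge0 //=.
by rewrite ler_pM2r ?invr_gt0 ?ltr0n ?addnS // ler_nat; lia.
Qed.

Lemma log_step_decr (a s t : R) : 0 <= a -> 0 < s -> s <= t -> log_step a t <= log_step a s.
Proof.
move=> a0 s0 st; have t0 := lt_le_trans s0 st; rewrite /log_step.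
rewrite -!ln_div ?posrE //; try lra.
rewrite ler_ln ?posrE ?divr_gt0 //; try lra.
have -> : (t + 2 * a) / t = 1 + 2 * a / t by field; rewrite gt_eqF.
have -> : (s + 2 * a) / s = 1 + 2 * a / s by field; rewrite gt_eqF.
by rewrite lerD2l ler_wpM2l ?mulr_ge0 // lef_pV2 ?posrE.
Qed.

(** Each of the [b] new terms is [log_step] at an argument at most [2 * b], and [log_step] is
    decreasing. *)
Lemma log_layer_grow a b : (0 < b)%N ->
  log_layer a b + b%:R * ln (1 + a%:R / b%:R) <= log_layer a b.+1.
Proof.
move=> b0; rewrite log_layerS lerD2l.
have -> : b%:R * ln (1 + a%:R / b%:R) = \sum_(j < b) log_step a%:R (2 * b%:R).
  rewrite sumr_const card_ord mulr_natl; congr (_ *+ _).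
  have br : 0 < b%:R :> R by rewrite ltr0n.
  have ar : 0 <= a%:R :> R by [].
  rewrite /log_step -ln_div ?posrE; try lra; congr ln; field.
  by rewrite gt_eqF.
apply: ler_sum => j _; apply: log_step_decr => //.
by rewrite -natrM ler_nat; have := ltn_ord j; lia.
Qed.

(** * Comparison of sums of [log_step] with integrals *)

Section FixedWidth.
Implicit Types s t : R.
Variable a : R.
Hypothesis a0 : 0 < a.

(** An antiderivative of [log_step a], continuous up to 0. *)
Definition theta t := xlnx (t + 2 * a) - xlnx t.

Lemma thetaS t : 0 <= t -> log_step a (t + 1) <= theta (t + 1) - theta t.
Proof.
have ap := a0; move=> t0.
have [|||c [/andP[c1 c2] ->]] := @mean_value R theta (log_step a) t (t + 1).
- by lra.
- move=> x /andP[x1 x2]; rewrite /theta; eapply isd_eq; first by isd_tac; lra.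
  by rewrite /log_step /=; field; neq0_tac.
- by move=> x /andP[x1 x2]; rewrite /theta; cont_tac; lra.
rewrite addrAC subrr add0r mulr1; apply: log_step_decr; lra.
Qed.

Lemma thetaS_le t : 0 < t -> theta (t + 1) - theta t <= log_step a t.
Proof.
have ap := a0; move=> t0.
have [|||c [/andP[c1 c2] ->]] := @mean_value R theta (log_step a) t (t + 1).
- by lra.
- move=> x /andP[x1 x2]; rewrite /theta; eapply isd_eq; first by isd_tac; lra.
  by rewrite /log_step /=; field; neq0_tac.
- by move=> x /andP[x1 x2]; rewrite /theta; cont_tac; lra.
rewrite addrAC subrr add0r mulr1; apply: log_step_decr; lra.
Qed.

(** The continuous analogue of [log_layer]: it vanishes at 0, and its derivative at [s] is the
    integral of [log_step a] from [s] to [2 * s]. *)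
Definition area s := a * xlnx a - 2^-1 * (s * xlnx s)
  - 2^-1 * ((2 * a + s) * xlnx (2 * a + s)) + (a + s) * xlnx (a + s)
  + 2 * a * (a + s) * ln 2.

Definition area_deriv s := - xlnx s - xlnx (2 * a + s) + 2 * xlnx (a + s) + 2 * a * ln 2.

Lemma ln_double t : 0 < t -> ln (2 * t) = ln 2 + ln t :> R.
Proof. by move=> t0; rewrite lnM ?posrE. Qed.

Lemma area_derivE s : 0 <= s -> area_deriv s = theta (2 * s) - theta s.
Proof.
rewrite le_eqVlt => /orP[/eqP <-|s0]; rewrite /area_deriv /theta /xlnx.
  by rewrite mulr0 !addr0 !mul0r add0r ln_double //; ring.
have -> : 2 * s + 2 * a = 2 * (a + s) by ring.
rewrite (@ln_double s) // (@ln_double (a + s)) ?addr_gt0 //.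
by rewrite [s + 2 * a]addrC; ring.
Qed.

Lemma area0 : area 0 = 0.
Proof. by rewrite /area /xlnx !addr0 ln_double //; field. Qed.

Lemma isd_area s : 0 < s -> isd s area (area_deriv s).
Proof.
have ap := a0; move=> s0; rewrite /area; eapply isd_eq; first by isd_tac; lra.
by rewrite /area_deriv /xlnx /=; field; neq0_tac.
Qed.

Lemma cont_area s : 0 <= s -> cont s area.
Proof.
have ap := a0.
by move=> s0; rewrite /area; cont_tac; lra.
Qed.

(** The derivative is nonnegative because [x * (2 * a + x) <= (a + x) ^+ 2]. *)
Lemma area_deriv_incr s t : 0 <= s -> s < t -> area_deriv s <= area_deriv t.
Proof.
have ap := a0; move=> s0 st; pose d x := 2 * ln (a + x) - ln x - ln (2 * a + x).
have [||c [/andP[c1 c2] e]] := @mean_value R area_deriv d s t st.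
- move=> x /andP[x1 x2]; rewrite /area_deriv; eapply isd_eq; first by isd_tac; lra.
  by rewrite /d /=; field; neq0_tac.
- by move=> x /andP[x1 x2]; rewrite /area_deriv; cont_tac; lra.
rewrite -subr_ge0 e mulr_ge0 //; last by lra.
have h : ln (c * (2 * a + c)) <= ln ((a + c) * (a + c)).
  by rewrite ler_ln ?posrE ?mulr_gt0 //; nra.
by move: h; rewrite !lnM ?posrE /d; lra.
Qed.

Lemma area_step s : 0 <= s ->
  area_deriv s <= area (s + 1) - area s <= area_deriv (s + 1).
Proof.
have ap := a0; move=> s0.
have [|||c [/andP[c1 c2] ->]] := @mean_value R area area_deriv s (s + 1).
- by lra.
- by move=> x /andP[x1 x2]; apply: isd_area; lra.
- by move=> x /andP[x1 x2]; apply: cont_area; lra.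
rewrite [_ + 1 - _]addrAC subrr add0r mulr1.
by rewrite !area_deriv_incr; lra.
Qed.

Lemma area_profile s : 0 < s -> area s = (a + s) ^+ 2 * layered_f (a / (a + s)).
Proof.
have ap := a0; move=> s0; have n0 : 0 < a + s by lra.
have -> : layered_f (a / (a + s)) = (a / (a + s)) ^+ 2 * (ln a - ln (a + s))
   - 2^-1 * (s / (a + s)) ^+ 2 * (ln s - ln (a + s))
   - 2^-1 * ((2 * a + s) / (a + s)) ^+ 2 * (ln (2 * a + s) - ln (a + s))
   + 2 * (a / (a + s)) * ln 2.
  rewrite -!ln_div ?posrE //; last by lra.
  rewrite /layered_f.
  have -> : 1 - a / (a + s) = s / (a + s) by field; rewrite gt_eqF.
  by have -> : 1 + a / (a + s) = (2 * a + s) / (a + s) by field; rewrite gt_eqF.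
by rewrite /area /xlnx; field; rewrite gt_eqF.
Qed.

Lemma sum_log_step_le (b : nat) :
  \sum_(j < b) log_step a (b + j.+1)%:R <= area_deriv b%:R.
Proof.
have le m : \sum_(j < m) log_step a (b + j.+1)%:R <= theta (b + m)%:R - theta b%:R.
  elim: m => [|m IH]; first by rewrite big_ord0 addn0 subrr.
  rewrite big_ord_recr /= addnS -natr1.
  by have := @thetaS (b + m)%:R (ler0n _ _); lra.
by rewrite area_derivE // (_ : 2 * b%:R = (b + b)%:R) // natrD; ring.
Qed.

Lemma sum_log_step_ge (b : nat) :
  area_deriv (b.+1)%:R - log_step a 1 <= \sum_(j < b) log_step a (b + j.+1)%:R.
Proof.
have le m : theta (b + m).+1%:R - theta b.+1%:R <= \sum_(j < m) log_step a (b + j.+1)%:R.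
  elim: m => [|m IH]; first by rewrite big_ord0 addn0 subrr.
  rewrite big_ord_recr /= addnS -[(b + m).+2%:R]natr1.
  by have := @thetaS_le (b + m).+1%:R (ltr0Sn _ _); lra.
(* The integral up to [2 * b.+1] has one unit interval more than the sum; it is bounded by
   [log_step a 1]. *)
rewrite area_derivE // (_ : 2 * b.+1%:R = (b + b).+1%:R + 1); last first.
  by rewrite natr1 -natrM; congr (_%:R); lia.
have := le b; have := @thetaS_le (b + b).+1%:R (ltr0Sn _ _).
have := @log_step_decr a 1 (b + b).+1%:R (ltW a0) ltr01.
by rewrite ler1n => /(_ isT); lra.
Qed.
End FixedWidth.

Lemma log_layer_le_area a b : (0 < a)%N -> log_layer a b <= area a%:R b%:R.
Proof.
move=> a0; have ar : 0 < a%:R :> R by rewrite ltr0n.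
elim: b => [|b IH]; first by rewrite log_layer0r area0.
rewrite log_layerS -natr1; have := sum_log_step_le ar b.
by have /andP[] := @area_step _ ar b%:R (ler0n _ _); lra.
Qed.

Lemma log_layer_ge_area a b : (0 < a)%N ->
  area a%:R b%:R - b%:R * log_step a%:R 1 <= log_layer a b.
Proof.
move=> a0; have ar : 0 < a%:R :> R by rewrite ltr0n.
elim: b => [|b IH]; first by rewrite log_layer0r area0 // mul0r subr0.
rewrite log_layerS; have := sum_log_step_ge ar b.
have /andP[] := @area_step _ ar b%:R (ler0n _ _); rewrite natr1 => _.
have : b.+1%:R * log_step a%:R 1 = b%:R * log_step a%:R 1 + log_step a%:R 1 :> R.
  by rewrite -natr1 mulrDl mul1r.
lra.
Qed.

Lemma log_layer_le a b : (0 < a)%N -> (0 < b)%N ->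
  log_layer a b <= (a + b)%:R ^+ 2 * layered_f (a%:R / (a + b)%:R).
Proof.
move=> a0 b0; have ar : 0 < a%:R :> R by rewrite ltr0n.
have br : 0 < b%:R :> R by rewrite ltr0n.
by rewrite natrD -area_profile // log_layer_le_area.
Qed.

Lemma log_layer_ge a b : (0 < a)%N -> (0 < b)%N ->
  (a + b)%:R ^+ 2 * layered_f (a%:R / (a + b)%:R)
    - (a + b)%:R * ln (1 + 2 * (a + b)%:R) <= log_layer a b.
Proof.
move=> a0 b0; have ar : 0 < a%:R :> R by rewrite ltr0n.
have br : 0 < b%:R :> R by rewrite ltr0n.
rewrite natrD -area_profile //; have := log_layer_ge_area b a0.
have l1 : 0 <= log_step a%:R 1 by rewrite /log_step ln1 subr0 ln_ge0 //; lra.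
have l2 : log_step a%:R 1 <= ln (1 + 2 * (a%:R + b%:R)).
  by rewrite /log_step ln1 subr0 ler_ln ?posrE; lra.
nra.
Qed.

End LayerAsymptotics.

(** * The maximizers *)

Section Maximizers.
Variable R : realType.
Local Notation cont x f := (continuous_at (x : R) (f : R -> R)).

Definition log_max (n : nat) : R := ln (max_layered R n).
Local Notation V := log_max.

(** First in the list of sizes, hence the last block: [q] is an optimal choice in the recursion for
    [n]. *)
Definition first_layer n q := (0 < q <= n)%N /\ V n = V (n - q) + log_layer R (n - q) q.

Lemma optimal_first_layer n q b : optimal R n (q :: b) -> first_layer n q.
Proof.
case/optimal_cons => qn _ e; split => //.
by rewrite /log_max e lnM ?posrE ?max_layered_gt0 ?layer_factor_gt0.
Qed.

Lemma first_layer_exists n : (0 < n)%N -> exists q, first_layer n q.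
Proof.
move=> n0; have [[|q b] ob] := optimal_exists R n.
  by case: ob => _ /= e; rewrite -e in n0.
by exists q; apply: optimal_first_layer ob.
Qed.

Lemma log_max_cons p q : (0 < q)%N -> V p + log_layer R p q <= V (p + q).
Proof.
move=> q0; rewrite -lnM ?posrE ?max_layered_gt0 ?layer_factor_gt0 //.
by rewrite ler_ln ?posrE ?mulr_gt0 ?max_layered_gt0 ?layer_factor_gt0 // max_layered_cons.
Qed.

Lemma log_max0 : V 0 = 0.
Proof.
have [[|q b] [b1 /= sb vb]] := optimal_exists R 0; first by rewrite /log_max -vb ln1.
by move: b1 sb {vb} => /andP[]; case: q.
Qed.

Lemma log_maxS n : V n <= V n.+1.
Proof.
have := @log_max_cons n 1 isT; rewrite addn1; apply: le_trans.
rewrite lerDl log_layerS log_layer0r big_ord0 addr0 //.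
Qed.

Lemma log_max_ge0 n : 0 <= V n.
Proof. by elim: n => [|n IH]; rewrite ?log_max0 // (le_trans IH) // log_maxS. Qed.

Lemma nat_large (x : R) : exists N : nat, forall n : nat, (N <= n)%N -> x <= n%:R.
Proof.
exists (Num.truncn `|x|).+1 => n le; apply: le_trans (ler_norm x) _.
have /andP[_ h] := truncn_itv (normr_ge0 x).
by apply: le_trans (ltW h) _; rewrite ler_nat.
Qed.

Lemma ln_small (e : R) : 0 < e ->
  exists N : nat, forall n : nat, (N <= n)%N -> ln (1 + 2 * n%:R) <= e * n%:R.
Proof.
(* The constant comes from [ln (1 + 2 * n) <= 2 * sqrt (1 + 2 * n)] and
   [4 * (1 + 2 * n) <= 12 * n]. *)
move=> e0; have [N h] := nat_large (12 / e ^+ 2 + 1); exists N => n /h {}h.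
have e2 : 0 < e ^+ 2 by rewrite exprn_gt0.
have t0 : 0 < 12 / e ^+ 2 by rewrite divr_gt0.
have n1 : 1 <= n%:R :> R by lra.
have s0 : 0 < Num.sqrt (1 + 2 * n%:R) :> R by rewrite sqrtr_gt0; lra.
have -> : ln (1 + 2 * n%:R) = 2 * ln (Num.sqrt (1 + 2 * n%:R)) :> R.
  have sE : Num.sqrt (1 + 2 * n%:R) ^+ 2 = 1 + 2 * n%:R :> R by rewrite sqr_sqrtr //; lra.
  by rewrite -[in LHS]sE lnXn //; ring.
have := ln_sublinear s0 => lns.
have : Num.sqrt (1 + 2 * n%:R) <= e * n%:R / 2.
  have -> : e * n%:R / 2 = Num.sqrt ((e * n%:R / 2) ^+ 2).
    by rewrite sqrtr_sqr ger0_norm //; nra.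
  rewrite ler_wsqrtr //.
  have : 12 <= e ^+ 2 * n%:R by rewrite mulrC -ler_pdivrMr //; lra.
  rewrite (_ : (e * n%:R / 2) ^+ 2 = e ^+ 2 * n%:R * n%:R / 4); last by field.
  nra.
lra.
Qed.

Variable alpha : R.
Hypotheses (alpha01 : 0 < alpha < 1) (crit_alpha : crit alpha = 0).
Variables (xl xr : R).
Hypotheses (xl_bounds : 0 < xl < alpha) (xr_bounds : alpha < xr < 1).
Hypotheses (crit_xl : 0 < crit xl) (crit_xr : crit xr < 0).
Local Notation gamma := (ratio alpha).
Local Notation loss := (loss alpha).

Let loss0 := loss_ge0 alpha01 crit_alpha xl_bounds xr_bounds crit_xl crit_xr.

(** A layer of size 2 after one of size 1 has a positive contribution, so [layered_f] is positive at
    1/3, and the loss there is nonnegative. *)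
Lemma gamma_gt0 : 0 < gamma.
Proof.
have := @log_layer_le R 1 2 isT isT.
move=> h; have l2 : 0 < log_layer R 1 2.
  apply: lt_le_trans (log_layer_grow R 1 (isT : 0 < 1)%N).
  by rewrite log_layerS log_layer0r big_ord0 addr0 add0r mul1r ln_gt0 // divr1; lra.
have /loss0 : 0 < (1 / (1 + 2)%:R : R) < 1 by rewrite (_ : (1 + 2)%:R = 3) //; lra.
rewrite /loss; move: h; rewrite (_ : (1 + 2)%:R = 3) //; set t := layered_f _ => h1 h2.
have : 0 < t by nra.
nra.
Qed.

Definition gap n : R := gamma * n%:R ^+ 2 - V n.

Lemma gap_step n q : first_layer n q -> (q < n)%N ->
  gap (n - q) + n%:R ^+ 2 * loss ((n - q)%:R / n%:R) <= gap n.
Proof.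
move=> [/andP[q0 qn] vE] lt; have a0 : (0 < n - q)%N by rewrite subn_gt0.
have := @log_layer_le R _ _ a0 q0; rewrite subnK // => h.
have n0 : n%:R != 0 :> R by rewrite pnatr_eq0; lia.
rewrite /gap vE /loss.
have -> : n%:R ^+ 2 * (gamma * (1 - ((n - q)%:R / n%:R) ^+ 2) - layered_f ((n - q)%:R / n%:R))
  = gamma * n%:R ^+ 2 - gamma * (n - q)%:R ^+ 2 - n%:R ^+ 2 * layered_f ((n - q)%:R / n%:R) :> R.
  by field.
lra.
Qed.

Lemma quot_bounds n q : (0 < q < n)%N -> 0 < ((n - q)%:R / n%:R : R) < 1.
Proof.
move=> /andP[q0 qn]; have n0 : 0 < n%:R :> R by rewrite ltr0n; lia.
apply/andP; split; first by rewrite divr_gt0 // ltr0n subn_gt0.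
by rewrite ltr_pdivrMr // mul1r ltr_nat; lia.
Qed.

Lemma gap_full n : first_layer n n -> gap n = gamma * n%:R ^+ 2.
Proof. by case=> _; rewrite subnn log_layer0l log_max0 addr0 /gap => ->; rewrite subr0. Qed.

Lemma gap_ge0 n : 0 <= gap n.
Proof.
have g0 := gamma_gt0; elim/ltn_ind: n => -[|n] IH.
  by rewrite /gap log_max0 expr0n mulr0 subr0.
have [q fq] := @first_layer_exists n.+1 isT; have [/andP[q0 qn] _] := fq.
have [e|ne] := eqVneq q n.+1.
  by rewrite gap_full -?[in X in first_layer _ X]e // mulr_ge0 ?exprn_ge0 // ltW.
have lt : (q < n.+1)%N by rewrite ltn_neqAle ne.
apply: le_trans (gap_step fq lt); rewrite addr_ge0 //; first by apply: IH; lia.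
by rewrite mulr_ge0 ?exprn_ge0 // loss0 // quot_bounds // q0.
Qed.

Lemma loss_cont : forall e : R, 0 < e -> exists2 d : R, 0 < d &
  forall t, `|t - alpha| < d -> `|loss t| < e.
Proof.
have c : cont alpha loss.
  rewrite /loss; apply: (@cont_add _ _ (fun x => gamma * (1 - x ^+ 2))); first by cont_tac.
  by apply: cont_opp; apply: cont_profile.
have l0 : loss alpha = 0 by rewrite lossE // subrr mulr0.
move=> e e0; have [d d0 h] := cont_eps c e0; exists d => // t /h.
by rewrite l0 subr0.
Qed.

(** Cutting at the integer part of [alpha * n] costs little at each step, and the sizes decrease
    geometrically. *)
Lemma gap_small (e : R) : 0 < e ->
  exists N : nat, forall n : nat, (N <= n)%N -> gap n <= e * n%:R ^+ 2.
Proof.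
move=> e0; have /andP[a0 a1] := alpha01; have g0 := gamma_gt0.
(* The steps cost at most [2 * e2] times the square of the size; summed with ratio [alpha ^+ 2],
   this gives [e / 2]. *)
pose e2 := e * (1 - alpha ^+ 2) / 4.
have e20 : 0 < e2 by rewrite divr_gt0 // mulr_gt0 //; nra.
have [d d0 hd] := loss_cont e20.
have [N1 h1] := ln_small e20.
(* These terms make the rounding error of [a / n] less than [d] and the integer part [a]
   positive. *)
have [N2 h2] := nat_large (2 / d + 1 / alpha + 1).
pose N := maxn N1 N2.
have step n : (N <= n)%N -> exists a : nat, [/\ (a < n)%N, a%:R <= alpha * n%:R &
    gap n <= gap a + 2 * e2 * n%:R ^+ 2].
  rewrite geq_max => /andP[/h1 {}h1 /h2 {}h2].
  have d20 : 0 < 2 / d by rewrite divr_gt0.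
  have da0 : 0 < 1 / alpha by rewrite divr_gt0.
  have n0 : 0 < n%:R :> R by lra.
  have an1 : 1 <= alpha * n%:R.
    by rewrite mulrC -ler_pdivrMr //; lra.
  pose a := Num.truncn (alpha * n%:R).
  have /andP[a_le a_gt] : a%:R <= alpha * n%:R < a.+1%:R.
    by apply: truncn_itv; rewrite mulr_ge0 // ltW.
  have ap : (0 < a)%N by move: (le_lt_trans an1 a_gt); rewrite ltr1n.
  have an : (a < n)%N.
    by rewrite -(ltr_nat R); apply: le_lt_trans a_le _; rewrite gtr_pMl.
  exists a; split => //.
  have q0 : (0 < n - a)%N by rewrite subn_gt0.
  have := @log_layer_ge R a (n - a) ap q0; have := log_max_cons a q0.
  rewrite subnKC ?(ltnW an) // => v1 v2.
  have : `|a%:R / n%:R - alpha| < d.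
    have -> : a%:R / n%:R - alpha = - ((alpha * n%:R - a%:R) / n%:R).
      by field; rewrite gt_eqF.
    rewrite normrN ger0_norm; last by apply: divr_ge0; [rewrite subr_ge0|apply: ltW].
    rewrite ltr_pdivrMr //; move: a_gt; rewrite -natr1.
    have : 2 <= d * n%:R by rewrite mulrC -ler_pdivrMr //; lra.
    lra.
  move=> /hd; rewrite ltr_norml => /andP[_ lt].
  have lE : n%:R ^+ 2 * loss (a%:R / n%:R) = gamma * n%:R ^+ 2 - gamma * a%:R ^+ 2
      - n%:R ^+ 2 * layered_f (a%:R / n%:R).
    by rewrite /loss; field; rewrite gt_eqF.
  have : n%:R ^+ 2 * loss (a%:R / n%:R) <= n%:R ^+ 2 * e2.
    by rewrite ler_pM2l ?exprn_gt0 // ltW.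
  have : n%:R * ln (1 + 2 * n%:R) <= n%:R * (e2 * n%:R) by rewrite ler_pM2l.
  rewrite /gap; nra.
(* Below [N], where no step is available, the gap is at most [K] because [V] is nonnegative. *)
pose K := gamma * N%:R ^+ 2.
have K0 : 0 <= K by rewrite mulr_ge0 ?exprn_ge0 // ltW.
have bound n : gap n <= K + e / 2 * n%:R ^+ 2.
  elim/ltn_ind: n => n IH; have [le|lt] := ssrnat.leqP N n.
    have [a [an a_le ga]] := step n le; have := IH a an.
    have : a%:R ^+ 2 <= (alpha * n%:R) ^+ 2 :> R by rewrite lerXn2r ?nnegrE // mulr_ge0 // ltW.
    move: ga; rewrite exprMn /e2; set n2 := n%:R ^+ 2; set a2 := a%:R ^+ 2; nra.
  have : n%:R ^+ 2 <= N%:R ^+ 2 :> R by rewrite lerXn2r ?nnegrE // ler_nat ltnW.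
  have : 0 <= n%:R ^+ 2 :> R by rewrite exprn_ge0.
  have := log_max_ge0 n; rewrite /gap /K; nra.
have [N3 h3] := nat_large (K * 2 / e + 1); exists N3 => n /h3 {}h3.
apply: le_trans (bound n) _.
have t0 : 0 <= K * 2 / e by apply: divr_ge0; [apply: mulr_ge0|apply: ltW].
have : K * 2 <= n%:R * e by rewrite -ler_pdivrMr //; lra.
have : n%:R <= n%:R ^+ 2 :> R by rewrite expr2 ler_peMl //; lra.
nra.
Qed.

Lemma first_layer_cases n q : first_layer n q -> q = n \/ (q < n)%N.
Proof. by case=> /andP[_]; rewrite leq_eqVlt => /orP[/eqP|]; [left|right]. Qed.

(** * Growth of the maximum, by descent to a large last layer *)

Section Descent.
Variables (x0 x1 c k : R).
Hypotheses (x0_bounds : alpha < x0 < 1) (x1_bounds : 0 < x1 < alpha).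
Hypotheses (c0 : 0 < c) (k0 : 0 < k).
Hypothesis loss_x0 : forall x, x0 <= x < 1 -> c * (1 - x) <= loss x.
Hypothesis loss_x1 : forall x, 0 < x <= x1 -> k <= loss x.

(** The bound on the gap survives the removal of a small layer [q], which lowers the gap by at least
    [d * M * q]. As the gap is nonnegative, the remaining size stays above [M], so the descent ends
    at a layer of proportional size. *)
Lemma growth_descent (d M : R) (m : nat) : 0 < d -> d <= c -> d <= k -> d <= gamma ->
  0 < M -> M < m%:R -> gap m < d * M * (m%:R - M) ->
  (1 - x0) * ln (1 + x1) * M <= V m.+1 - V m.
Proof.
have /andP[ax0 x01] := x0_bounds; have /andP[x10 x1a] := x1_bounds.
have /andP[al0 al1] := alpha01.
move=> d0 dc dk dg M0; elim/ltn_ind: m => m IH Mm gm.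
have mr : 0 < m%:R :> R by lra.
have m0 : (0 < m)%N by rewrite -(ltr_nat R).
(* This excludes a single layer and a proportion below [x1]: each would force a gap of at least
   [d * m%:R ^+ 2]. *)
have quad : d * M * (m%:R - M) < d * m%:R ^+ 2.
  rewrite -mulrA ltr_pM2l // expr2; nra.
have [q fq] := first_layer_exists m0.
have [e|lt] := first_layer_cases fq.
  have g : gap m = gamma * m%:R ^+ 2 by apply: gap_full; rewrite -[X in first_layer _ X]e.
  have : d * m%:R ^+ 2 <= gamma * m%:R ^+ 2 by rewrite ler_pM2r // exprn_gt0.
  lra.
have [/andP[q0 qm] vE] := fq.
have gs := gap_step fq lt; have ga := gap_ge0 (m - q).
have qb := @quot_bounds m q; rewrite q0 lt in qb; have /andP[xx0 xx1] := qb isT.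
set x : R := (m - q)%:R / m%:R in gs xx0 xx1.
have ae : (m - q)%:R = x * m%:R :> R by rewrite /x divfK // gt_eqF.
have qe : q%:R = (1 - x) * m%:R :> R.
  by move: ae; rewrite natrB 1?ltnW //; lra.
have m2 : 0 < m%:R ^+ 2 :> R by rewrite exprn_gt0.
have [xle|xgt] := lerP x0 x.
  have lx : c * (1 - x) <= loss x by apply: loss_x0; rewrite xle.
  have lx2 : d * M * q%:R <= m%:R ^+ 2 * loss x.
    apply: (@le_trans _ _ (m%:R ^+ 2 * (d * (1 - x)))).
      rewrite qe expr2; have : 0 <= d * (1 - x) * m%:R * (m%:R - M).
        by rewrite !mulr_ge0 ?subr_ge0 ?ltW.
      nra.
    rewrite ler_pM2l //; apply: le_trans lx; rewrite ler_pM2r //; lra.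
  have g2 : gap (m - q) < d * M * ((m - q)%:R - M).
    by rewrite natrB 1?ltnW //; nra.
  have Ma : M < (m - q)%:R.
    rewrite -subr_gt0; have dM : 0 < d * M by rewrite mulr_gt0.
    by rewrite -(pmulr_rgt0 _ dM); apply: le_lt_trans g2.
  have := IH (m - q)%N _ Ma g2; rewrite ltn_subrL q0 m0 => /(_ isT) h.
  (* The growth at [m - q] carries over to [m]: putting the layer [q] back on a larger base
     contributes at least as much. *)
  apply: le_trans h _; have := log_max_cons (m - q).+1 q0.
  have := log_layer_mono R (m - q) q.
  by rewrite addSn subnK //; lra.
have [xle|xgt1] := lerP x x1.
  have lx : k <= loss x by apply: loss_x1; rewrite xx0.
  have : m%:R ^+ 2 * d <= m%:R ^+ 2 * loss x by rewrite ler_pM2l //; lra.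
  lra.
(* The proportion now lies between [x1] and [x0], and the last layer is enlarged by one. *)
have := log_layer_grow R (m - q) q0; have := log_max_cons (m - q) (ltn0Sn q).
rewrite addnS subnK // vE => h1 h2.
have qr : 0 < q%:R :> R by rewrite ltr0n.
have l1 : ln (1 + x1) <= ln (1 + (m - q)%:R / q%:R).
  rewrite ler_ln ?posrE; [|lra|]; last by rewrite ltr_wpDr // divr_ge0.
  rewrite lerD2l ler_pdivlMr // ae qe; have : x1 * (1 - x) <= x by nra.
  nra.
have l0 : 0 <= ln (1 + x1) by rewrite ln_ge0; lra.
have : (1 - x0) * M <= q%:R by rewrite qe; apply: ler_pM; lra.
have : q%:R * ln (1 + x1) <= q%:R * ln (1 + (m - q)%:R / q%:R) by rewrite ler_pM2l.
nra.
Qed.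
End Descent.

Lemma log_max_growth : exists2 c : R, 0 < c &
  exists N : nat, forall n : nat, (N <= n)%N -> c * n%:R <= V n.+1 - V n.
Proof.
have /andP[a0 a1] := alpha01; have g0 := gamma_gt0.
pose x0 := (alpha + 1) / 2; pose x1 := alpha / 2.
have b0 : alpha < x0 < 1 by rewrite /x0; lra.
have b1 : 0 < x1 < alpha by rewrite /x1; lra.
have [c c0 hc] := loss_right alpha01 crit_alpha xr_bounds crit_xr b0.
have [k k0 hk] := loss_left alpha01 crit_alpha xl_bounds crit_xl b1.
pose d := Num.min c (Num.min k gamma).
have d0 : 0 < d by rewrite !lt_min c0 k0.
(* With [M = n / 2], the descent needs a gap below [d * n ^+ 2 / 4]. *)
have d80 : 0 < d / 8 by lra.
have [N hN] := gap_small d80.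
have l0 : 0 < ln (1 + x1) by rewrite ln_gt0 //; rewrite /x1; lra.
exists ((1 - x0) * ln (1 + x1) / 2).
  by rewrite divr_gt0 // mulr_gt0 //; rewrite /x0; lra.
exists (maxn N 1) => n; rewrite geq_max => /andP[/hN gn n0].
have nr : 0 < n%:R :> R by rewrite ltr0n.
have -> : (1 - x0) * ln (1 + x1) / 2 * n%:R = (1 - x0) * ln (1 + x1) * (n%:R / 2) by field.
apply: (growth_descent b0 b1 hc hk d0).
- by rewrite /d ge_min lexx.
- by rewrite /d !ge_min lexx orbT.
- by rewrite /d !ge_min lexx !orbT.
- by lra.
- by lra.
apply: le_lt_trans gn _; have : 0 < d * n%:R ^+ 2 by rewrite mulr_gt0 ?exprn_gt0.
have -> : d * (n%:R / 2) * (n%:R - n%:R / 2) = d * n%:R ^+ 2 / 4 by field.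
lra.
Qed.

Lemma log_max_growth_sum (c : R) N a k : 0 < c ->
  (forall n : nat, (N <= n)%N -> c * n%:R <= V n.+1 - V n) -> (N <= a)%N ->
  c * a%:R * k%:R <= V (a + k) - V a.
Proof.
move=> c0 h Na; elim: k => [|k IH]; first by rewrite mulr0 addn0 subrr.
have := h (a + k)%N (leq_trans Na (leq_addr _ _)); rewrite addnS natrD -natr1 => h1.
have : 0 <= c * k%:R by rewrite mulr_ge0 // ltW.
nra.
Qed.

(** By the growth bound, passing from [n - q] to [n] gains at least [c * q * n / 2] when [q] is
    below [n / 2]. A layer of small proportion contributes at most half of that, by
    [profile_near_one] with [c / 4]. *)
Lemma first_layer_large : exists2 b0 : R, 0 < b0 < 1 &
  exists N : nat, forall n q : nat, (N <= n)%N -> first_layer n q -> b0 * n%:R <= q%:R.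
Proof.
have [c c0 [N hN]] := log_max_growth.
have c40 : 0 < c / 4 by lra.
have [b0 /andP[b00 b01] hb] := profile_near_one c40.
exists b0; first by lra.
exists (N.*2.+2) => n q Nn fq; rewrite leNgt; apply/negP => qlt.
have nr : 0 < n%:R :> R by rewrite ltr0n; lia.
have [e|lt] := first_layer_cases fq; first by move: qlt; rewrite e; nra.
have [/andP[q0 qn] vE] := fq; have qr : 0 < q%:R :> R by rewrite ltr0n.
have q2 : 2 * q%:R < n%:R :> R by nra.
have q2n : (q.*2 < n)%N by rewrite -(ltr_nat R) -mul2n natrM.
have Na : (N <= n - q)%N by move: Nn q2n; clear; lia.
have := log_max_growth_sum q c0 hN Na; rewrite subnK // vE => g.
have a0 : (0 < n - q)%N by rewrite subn_gt0.
have := log_layer_le R a0 q0; rewrite subnK // => lu.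
have xE : (n - q)%:R / n%:R = 1 - q%:R / n%:R :> R.
  by rewrite natrB //; field; rewrite gt_eqF.
have qb : 0 < (q%:R / n%:R : R) < b0 by rewrite divr_gt0 //= ltr_pdivrMr.
have := hb _ qb; rewrite -xE => lb.
have : n%:R ^+ 2 * layered_f ((n - q)%:R / n%:R) <= n%:R ^+ 2 * (c / 4 * (q%:R / n%:R)).
  by rewrite ler_pM2l // exprn_gt0.
have -> : n%:R ^+ 2 * (c / 4 * (q%:R / n%:R)) = c / 4 * q%:R * n%:R.
  by field; rewrite gt_eqF.
have : 2 * (n - q)%:R >= n%:R :> R by rewrite natrB //; lra.
have : 0 < c * q%:R by rewrite mulr_gt0.
nra.
Qed.

(** The loss at the optimal proportion is at most [gap n / n ^+ 2], which tends to 0. Away from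
    [alpha] it is bounded below; on the right this uses that the layer is at least [b0 * n]. *)
Lemma first_layer_cvg (e : R) : 0 < e -> exists N : nat, forall n q : nat,
  (N <= n)%N -> first_layer n q -> `|(n - q)%:R / n%:R - alpha| < e.
Proof.
move=> e0; have /andP[a0 a1] := alpha01; have g0 := gamma_gt0.
have [b0 /andP[b00 b01] [N1 h1]] := first_layer_large.
pose u := Num.min e (Num.min (alpha / 2) ((1 - alpha) / 2)).
have [u0 ue ua u1] : [/\ 0 < u, u <= e, u <= alpha / 2 & u <= (1 - alpha) / 2].
  by rewrite !lt_min !ge_min !lexx !orbT e0; split => //; lra.
have br : alpha < alpha + u < 1 by lra.
have bl : 0 < alpha - u < alpha by lra.
have [c c0 hc] := loss_right alpha01 crit_alpha xr_bounds crit_xr br.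
have [k k0 hk] := loss_left alpha01 crit_alpha xl_bounds crit_xl bl.
pose d := Num.min (c * b0) (Num.min k gamma) / 2.
have [d0 d1 d2 d3] : [/\ 0 < d, d < c * b0, d < k & d < gamma].
  have cb : 0 < c * b0 by rewrite mulr_gt0.
  have m0 : 0 < Num.min (c * b0) (Num.min k gamma) by rewrite !lt_min cb k0.
  have : Num.min (c * b0) (Num.min k gamma) <= c * b0 by rewrite ge_min lexx.
  have : Num.min (c * b0) (Num.min k gamma) <= k by rewrite !ge_min lexx orbT.
  have : Num.min (c * b0) (Num.min k gamma) <= gamma by rewrite !ge_min lexx !orbT.
  by rewrite /d; split; lra.
have [N2 h2] := gap_small d0.
exists (maxn 1 (maxn N1 N2)) => n q; rewrite !geq_max => /and3P[n0 n1 n2] fq.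
have nr : 0 < n%:R :> R by rewrite ltr0n.
have nn : 0 < n%:R ^+ 2 :> R by rewrite exprn_gt0.
have gn := h2 n n2; have qb := h1 n q n1 fq.
have [ee|lt] := first_layer_cases fq.
  have g : gap n = gamma * n%:R ^+ 2 by apply: gap_full; rewrite -[X in first_layer _ X]ee.
  have : d * n%:R ^+ 2 < gamma * n%:R ^+ 2 by rewrite (ltr_pM2r nn).
  by lra.
have [/andP[q0 qn] _] := fq.
have := gap_step fq lt; have ga := gap_ge0 (n - q).
have qqb := @quot_bounds n q; rewrite q0 lt in qqb; have /andP[xx0 xx1] := qqb isT.
have xq : 1 - (n - q)%:R / n%:R = q%:R / n%:R :> R.
  by rewrite natrB //; field; rewrite gt_eqF.
set x : R := (n - q)%:R / n%:R in xx0 xx1 xq *.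
move=> gs; have lx : loss x <= d.
  by rewrite -(ler_pM2l nn) [leRHS]mulrC; lra.
have xb : b0 <= 1 - x by rewrite xq ler_pdivlMr.
rewrite ltr_norml; apply/andP; split; rewrite ltNge; apply/negP => hx.
  have : k <= loss x by apply: hk; rewrite xx0; lra.
  lra.
have : c * (1 - x) <= loss x by apply: hc; lra.
have : c * b0 <= c * (1 - x) by rewrite ler_pM2l.
lra.
Qed.

(** Removing the first size [q] leaves an optimal list for [n - q], which is asymptotic to
    [alpha * n]; hence one factor [alpha] per index. *)
Lemma optimal_cvg (i : nat) (e : R) : 0 < e -> exists N : nat, forall (n : nat) b,
  (N <= n)%N -> optimal R n b ->
  `|(nth 0%N b i)%:R / n%:R - alpha ^+ i * (1 - alpha)| < e.
Proof.
have /andP[a0 a1] := alpha01.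
elim: i e => [|i IH] e e0.
  have [N h] := first_layer_cvg e0; exists (maxn 1 N) => n [|q b].
    by rewrite geq_max => /andP[n0 _] [_ /= sn _]; rewrite -sn in n0.
  rewrite geq_max => /andP[n0 nN] ob.
  have nr : 0 < n%:R :> R by rewrite ltr0n.
  have fq := optimal_first_layer ob; have [/andP[_ qn] _] := fq.
  have := h n q nN fq; rewrite /= expr0 mul1r distrC natrB //.
  by congr (`|_| < _); field; rewrite gt_eqF.
have e20 : 0 < e / 2 by lra.
have [N1 h1] := IH _ e20.
have m0 : 0 < Num.min (e / 2) (alpha / 2) by rewrite lt_min e20; lra.
have [N2 h2] := first_layer_cvg m0.
(* The remaining size exceeds [alpha * n / 2], so this makes it at least [N1]. *)
have [N3 h3] := nat_large (2 * N1%:R / alpha).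
exists (maxn 1 (maxn N2 N3)) => n [|q b].
  by rewrite !geq_max => /andP[n0 _] [_ /= sn _]; rewrite -sn in n0.
rewrite !geq_max => /and3P[n0 n2 n3] ob.
have nr : 0 < n%:R :> R by rewrite ltr0n.
have fq := optimal_first_layer ob; have [/andP[q0 qn] ob' _] := optimal_cons ob.
have := h2 n q n2 fq; rewrite lt_min => /andP[x1 x2].
have /andP[y1 y2] : alpha / 2 < (n - q)%:R / n%:R < 2 * alpha.
  by move: x2; rewrite ltr_norml; lra.
have an : (n - q)%:R / n%:R <= 1 :> R.
  by rewrite ler_pdivrMr // mul1r ler_nat leq_subr.
have aN : (N1 <= n - q)%N.
  rewrite -(ler_nat R); have := h3 n n3; rewrite ler_pdivrMr // => h.
  by move: y1; rewrite ltr_pdivlMr //; nra.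
have ar : 0 < (n - q)%:R :> R.
  by move: y1; rewrite ltr_pdivlMr //; apply: le_lt_trans; nra.
have := h1 _ b aN ob' => /=; set t : R := (nth 0%N b i)%:R / (n - q)%:R => h.
have -> : (nth 0%N b i)%:R / n%:R = t * ((n - q)%:R / n%:R) :> R.
  by rewrite /t; field; rewrite !gt_eqF.
move: h x1 an y1; set x : R := (n - q)%:R / n%:R => h x1 an y1.
have -> : t * x - alpha ^+ i.+1 * (1 - alpha) =
    (t - alpha ^+ i * (1 - alpha)) * x + alpha ^+ i * (1 - alpha) * (x - alpha).
  by rewrite exprS; ring.
apply: le_lt_trans (ler_normD _ _) _; rewrite normrM [X in _ + X]normrM.
have p0 : 0 <= alpha ^+ i * (1 - alpha) by rewrite mulr_ge0 ?exprn_ge0 //; lra.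
have p1 : alpha ^+ i * (1 - alpha) <= 1.
  have : alpha ^+ i <= 1 by rewrite exprn_ile1 //; lra.
  have : 0 <= alpha ^+ i by rewrite exprn_ge0 // ltW.
  nra.
rewrite (ger0_norm p0).
have xx0 : 0 <= x by lra.
rewrite (ger0_norm xx0).
move: h x1; set u := `|t - _|; set v := `|x - alpha| => h x1.
have u0 : 0 <= u by exact: normr_ge0.
have v0 : 0 <= v by exact: normr_ge0.
have : u * x <= u by nra.
have : alpha ^+ i * (1 - alpha) * v <= v by nra.
lra.
Qed.

End Maximizers.

(** * Numerical bounds *)

Section LogSeries.
Variable R : realType.
Implicit Types (x y t z : R).
Local Notation isd x f d := (is_derive (x : R) (1 : R) (f : R -> R) (d : R)).

(** In Horner form, the sum over [k < K] of [z ^+ k / (m + 2 * k)]; for [m = 1] and [z = y ^+ 2],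
    multiplication by [y] gives a partial sum of atanh. *)
Fixpoint atanh_series (K m : nat) z : R :=
  if K is k.+1 then m%:R^-1 + z * atanh_series k m.+2 z else 0.

Fixpoint geometric (K : nat) z : R := if K is k.+1 then 1 + z * geometric k z else 0.

Lemma geometricE K z : geometric K z * (1 - z) = 1 - z ^+ K.
Proof.
elim: K => [|K IH] /=; first by rewrite mul0r expr0 subrr.
by rewrite mulrDl mul1r -mulrA IH exprS; ring.
Qed.

Lemma isd_expr n t : isd t (fun u => u ^+ n.+1) (n.+1%:R * t ^+ n).
Proof.
elim: n => [|n IH]; first by rewrite expr0 mulr1; apply: isd_id.
rewrite (_ : (fun u => u ^+ n.+2) = fun u => u * u ^+ n.+1); last first.
  by apply/funext => u; rewrite exprS.
apply: isd_eq (isd_mul (isd_id t) IH) _.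
by rewrite mulr1 -[n.+2%:R]natr1 mulrDl mul1r mulrCA exprS.
Qed.

Lemma isd_atanh K m t : isd t (fun u => u ^+ m.+1 * atanh_series K m.+1 (u ^+ 2))
  (t ^+ m * geometric K (t ^+ 2)).
Proof.
elim: K m => [|K IH] m /=.
  rewrite (_ : (fun u => _) = fun=> 0); last by apply/funext => u; rewrite mulr0.
  by rewrite mulr0; apply: isd_cst.
rewrite (_ : (fun u => _) = fun u => u ^+ m.+1 * m.+1%:R^-1 +
   u ^+ m.+3 * atanh_series K m.+3 (u ^+ 2)); last first.
  by apply/funext => u; rewrite mulrDr mulrA -exprD addn2.
apply: isd_eq (isd_add (isd_mul (isd_expr m t) (isd_cst t m.+1%:R^-1)) (IH m.+2)) _.
rewrite mulr0 add0r mulKf ?pnatr_eq0 //.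
by rewrite mulrDr mulr1 mulrA -exprD addn2.
Qed.

(* ln ((1 + y) / (1 - y)) = 2 atanh y. *)
Lemma atanh_bounds K y : 0 < y < 1 ->
  0 <= ln (1 + y) - ln (1 - y) - 2 * y * atanh_series K 1 (y ^+ 2)
    <= 2 * y * (y ^+ 2) ^+ K / (1 - y ^+ 2).
Proof.
move=> /andP[y0 y1].
pose T t := ln (1 + t) - ln (1 - t) - 2 * (t ^+ 1 * atanh_series K 1 (t ^+ 2)).
(* The derivative of the truncation error, namely twice the tail of the geometric series in
   [t ^+ 2]. *)
pose dT t := 2 * (t ^+ 2) ^+ K / (1 - t ^+ 2).
have dTP t : 0 <= t < 1 -> isd t T (dT t).
  move=> /andP[t0 t1].
  have d1 : isd t (fun u => ln (1 + u) - ln (1 - u)) ((1 + t)^-1 + (1 - t)^-1).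
    eapply isd_eq; first by isd_tac; lra.
    by rewrite /=; field; neq0_tac.
  apply: isd_eq (isd_add d1 (isd_opp (isd_mul (isd_cst t 2) (isd_atanh K 0 t)))) _.
  rewrite mulr0 addr0 expr0 mul1r /dT.
  have z1 : 1 - t ^+ 2 != 0 by apply: lt0r_neq0; nra.
  have -> : (t ^+ 2) ^+ K = 1 - geometric K (t ^+ 2) * (1 - t ^+ 2).
    by rewrite geometricE; ring.
  by field; repeat (apply/andP; split) => //; apply: lt0r_neq0; lra.
have [||c [/andP[c0 cy] e]] := @mean_value R T dT 0 y y0.
- by move=> t /andP[? ?]; apply: dTP; lra.
- by move=> t /andP[? ?]; apply: isd_continuous (dTP t _); lra.
have T0 : T 0 = 0 by rewrite /T addr0 subr0 subrr expr1 mul0r mulr0 subr0.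
have Ty : T y = ln (1 + y) - ln (1 - y) - 2 * y * atanh_series K 1 (y ^+ 2).
  by rewrite /T expr1; ring.
rewrite -Ty; move: e; rewrite T0 !subr0 => ->; rewrite /dT.
have z0 : 0 <= c ^+ 2 <= y ^+ 2 by apply/andP; split; rewrite !expr2; nra.
have y2 : y ^+ 2 < 1 by rewrite expr2; nra.
have /andP[zc zy] := z0.
have v0 : 0 < (1 - y ^+ 2)^-1 by rewrite invr_gt0; lra.
have vc : (1 - c ^+ 2)^-1 <= (1 - y ^+ 2)^-1 by rewrite lef_pV2 ?posrE; lra.
have vc0 : 0 < (1 - c ^+ 2)^-1 by rewrite invr_gt0; lra.
have p0 : 0 <= (c ^+ 2) ^+ K by rewrite exprn_ge0.
have pc : (c ^+ 2) ^+ K <= (y ^+ 2) ^+ K by rewrite lerXn2r ?nnegrE // exprn_ge0 // ltW.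
apply/andP; split.
  by rewrite mulr_ge0 ?(ltW y0) // mulr_ge0 ?(ltW vc0) // mulr_ge0.
have -> : 2 * y * (y ^+ 2) ^+ K / (1 - y ^+ 2) = 2 * (y ^+ 2) ^+ K / (1 - y ^+ 2) * y by ring.
rewrite ler_pM2r // -!mulrA ler_pM2l //; apply: ler_pM => //; exact: ltW.
Qed.

(** The hypotheses are free of divisions by [1 - y] and [1 - y ^+ 2], so that for explicit numbers
    linear arithmetic decides them. *)
Lemma ln_upper K x y (hi : R) : 0 < y < 1 -> 0 < x -> x * (1 - y) <= 1 + y ->
  2 * y * (y ^+ 2) ^+ K <= (hi - 2 * y * atanh_series K 1 (y ^+ 2)) * (1 - y ^+ 2) ->
  ln x <= hi.
Proof.
move=> y01 x0 xy h; have /andP[_ b] := atanh_bounds K y01; have /andP[y0 y1] := y01.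
have y2 : 0 < 1 - y ^+ 2 by rewrite expr2; nra.
move: h; rewrite -ler_pdivrMr // => h.
have : ln (x * (1 - y)) <= ln (1 + y) by rewrite ler_ln ?posrE ?mulr_gt0 //; lra.
by rewrite lnM ?posrE //; lra.
Qed.

Lemma ln_lower K x y (l : R) : 0 < y < 1 -> 0 < x -> 1 + y <= x * (1 - y) ->
  l <= 2 * y * atanh_series K 1 (y ^+ 2) -> l <= ln x.
Proof.
move=> y01 x0 xy h; have /andP[b _] := atanh_bounds K y01; have /andP[y0 y1] := y01.
have : ln (1 + y) <= ln (x * (1 - y)) by rewrite ler_ln ?posrE ?mulr_gt0 //; lra.
by rewrite lnM ?posrE //; lra.
Qed.

(* Here y1 and y2 are approximations of (n - d) / (n + d), from below and above. *)
Lemma ln_bounds K n d y1 y2 lo hi : 0 < n -> 0 < d -> 0 < y1 < 1 -> 0 < y2 < 1 ->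
  d * (1 + y1) <= n * (1 - y1) -> n * (1 - y2) <= d * (1 + y2) ->
  lo <= 2 * y1 * atanh_series K 1 (y1 ^+ 2) ->
  2 * y2 * (y2 ^+ 2) ^+ K <= (hi - 2 * y2 * atanh_series K 1 (y2 ^+ 2)) * (1 - y2 ^+ 2) ->
  lo <= ln n - ln d <= hi.
Proof.
move=> n0 d0 y1b y2b h1 h2 h3 h4; rewrite -ln_div ?posrE //; apply/andP; split.
  apply: (ln_lower y1b _ _ h3); first exact: divr_gt0.
  by rewrite mulrAC ler_pdivlMr // mulrC.
apply: (ln_upper y2b _ _ h4); first exact: divr_gt0.
by rewrite mulrAC ler_pdivrMr // [leRHS]mulrC.
Qed.

End LogSeries.


(** * Enclosures of alpha and of gamma divided by [ln 2] *)

Section Numerics.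
Variable R : realType.

(* The critical point alpha is 0.43318183... *)
Definition bracket_right : R := 433 / 10 ^+ 3 + 182 / 10 ^+ 6.
Definition bracket_left : R := 433 / 10 ^+ 3 + 181 / 10 ^+ 6.
Local Notation xr := bracket_right.
Local Notation xl := bracket_left.

(* The logarithms of 2, 3, 5 and 7 are integral combinations of those of the
   four ratios 126/125, 225/224, 2401/2400 and 4375/4374. *)
Lemma ln_126_125_bounds :
  7 / 10 ^+ 3 + 968 / 10 ^+ 6 + 169 / 10 ^+ 9 + 649 / 10 ^+ 12 + 173 / 10 ^+ 15
    <= ln (2 : R) + 2 * ln 3 + ln 7 - 3 * ln 5
    <= 7 / 10 ^+ 3 + 968 / 10 ^+ 6 + 169 / 10 ^+ 9 + 649 / 10 ^+ 12 + 180 / 10 ^+ 15.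
Proof.
have <- : ln (2 * 3 ^+ 2 * 7) - ln (5 ^+ 3) = ln (2 : R) + 2 * ln 3 + ln 7 - 3 * ln 5.
  by rewrite ?lnM ?lnXn ?posrE ?mulr_gt0 ?exprn_gt0 //; ring.
apply: (@ln_bounds R 3 _ _
    (3 / 10 ^+ 3 + 984 / 10 ^+ 6 + 63 / 10 ^+ 9 + 745 / 10 ^+ 12 + 19 / 10 ^+ 15)
    (3 / 10 ^+ 3 + 984 / 10 ^+ 6 + 63 / 10 ^+ 9 + 745 / 10 ^+ 12 + 20 / 10 ^+ 15));
    rewrite /=; lra.
Qed.

Lemma ln_225_224_bounds :
  4 / 10 ^+ 3 + 454 / 10 ^+ 6 + 350 / 10 ^+ 9 + 349 / 10 ^+ 12 + 377 / 10 ^+ 15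
    <= 2 * ln (3 : R) + 2 * ln 5 - 5 * ln 2 - ln 7
    <= 4 / 10 ^+ 3 + 454 / 10 ^+ 6 + 350 / 10 ^+ 9 + 349 / 10 ^+ 12 + 384 / 10 ^+ 15.
Proof.
have <- : ln (3 ^+ 2 * 5 ^+ 2) - ln (2 ^+ 5 * 7) = 2 * ln (3 : R) + 2 * ln 5 - 5 * ln 2 - ln 7.
  by rewrite ?lnM ?lnXn ?posrE ?mulr_gt0 ?exprn_gt0 //; ring.
apply: (@ln_bounds R 3 _ _
    (2 / 10 ^+ 3 + 227 / 10 ^+ 6 + 171 / 10 ^+ 9 + 492 / 10 ^+ 12 + 204 / 10 ^+ 15)
    (2 / 10 ^+ 3 + 227 / 10 ^+ 6 + 171 / 10 ^+ 9 + 492 / 10 ^+ 12 + 205 / 10 ^+ 15));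
    rewrite /=; lra.
Qed.

Lemma ln_2401_2400_bounds :
  416 / 10 ^+ 6 + 579 / 10 ^+ 9 + 885 / 10 ^+ 12 + 213 / 10 ^+ 15
    <= 4 * ln (7 : R) - 5 * ln 2 - ln 3 - 2 * ln 5
    <= 416 / 10 ^+ 6 + 579 / 10 ^+ 9 + 885 / 10 ^+ 12 + 220 / 10 ^+ 15.
Proof.
have <- : ln (7 ^+ 4) - ln (2 ^+ 5 * 3 * 5 ^+ 2) = 4 * ln (7 : R) - 5 * ln 2 - ln 3 - 2 * ln 5.
  by rewrite ?lnM ?lnXn ?posrE ?mulr_gt0 ?exprn_gt0 //; ring.
apply: (@ln_bounds R 2 _ _
    (208 / 10 ^+ 6 + 289 / 10 ^+ 9 + 939 / 10 ^+ 12 + 595 / 10 ^+ 15)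
    (208 / 10 ^+ 6 + 289 / 10 ^+ 9 + 939 / 10 ^+ 12 + 596 / 10 ^+ 15));
    rewrite /=; lra.
Qed.

Lemma ln_4375_4374_bounds :
  228 / 10 ^+ 6 + 597 / 10 ^+ 9 + 554 / 10 ^+ 12 + 998 / 10 ^+ 15
    <= 4 * ln (5 : R) + ln 7 - ln 2 - 7 * ln 3
    <= 228 / 10 ^+ 6 + 597 / 10 ^+ 9 + 555 / 10 ^+ 12 + 5 / 10 ^+ 15.
Proof.
have <- : ln (5 ^+ 4 * 7) - ln (2 * 3 ^+ 7) = 4 * ln (5 : R) + ln 7 - ln 2 - 7 * ln 3.
  by rewrite ?lnM ?lnXn ?posrE ?mulr_gt0 ?exprn_gt0 //; ring.
apply: (@ln_bounds R 2 _ _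
    (114 / 10 ^+ 6 + 298 / 10 ^+ 9 + 777 / 10 ^+ 12 + 3 / 10 ^+ 15)
    (114 / 10 ^+ 6 + 298 / 10 ^+ 9 + 777 / 10 ^+ 12 + 4 / 10 ^+ 15));
    rewrite /=; lra.
Qed.

Lemma ln_primes_bounds :
  [/\ 693 / 10 ^+ 3 + 147 / 10 ^+ 6 + 180 / 10 ^+ 9 + 558 / 10 ^+ 12 <= ln (2 : R)
       <= 693 / 10 ^+ 3 + 147 / 10 ^+ 6 + 180 / 10 ^+ 9 + 561 / 10 ^+ 12,
      847 / 10 ^+ 3 + 297 / 10 ^+ 6 + 860 / 10 ^+ 9 + 386 / 10 ^+ 12 <= ln (7 : R) - ln 3
       <= 847 / 10 ^+ 3 + 297 / 10 ^+ 6 + 860 / 10 ^+ 9 + 389 / 10 ^+ 12,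
      559 / 10 ^+ 3 + 615 / 10 ^+ 6 + 787 / 10 ^+ 9 + 934 / 10 ^+ 12 <= ln (7 : R) - 2 * ln 2
       <= 559 / 10 ^+ 3 + 615 / 10 ^+ 6 + 787 / 10 ^+ 9 + 937 / 10 ^+ 12 &
      356 / 10 ^+ 3 + 674 / 10 ^+ 6 + 943 / 10 ^+ 9 + 937 / 10 ^+ 12 <= ln (2 : R) + ln 5 - ln 7
       <= 356 / 10 ^+ 3 + 674 / 10 ^+ 6 + 943 / 10 ^+ 9 + 940 / 10 ^+ 12].
Proof.
have /andP[f1 f2] := ln_126_125_bounds; have /andP[g1 g2] := ln_225_224_bounds.
have /andP[h1 h2] := ln_2401_2400_bounds; have /andP[k1 k2] := ln_4375_4374_bounds.
split; apply/andP; split; move: f1 f2 g1 g2 h1 h2 k1 k2;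
  move: (ln 2) (ln 3) (ln 5) (ln 7) => a b c d; lra.
Qed.

(* The bracket is close to 3/7, and 3/7, 1 - 3/7 and 1 + 3/7 have no prime
   factors other than 2, 3, 5 and 7. *)
Lemma ln_xr_bounds :
  - (836 / 10 ^+ 3 + 597 / 10 ^+ 6 + 315 / 10 ^+ 9 + 971 / 10 ^+ 12)
    <= ln xr
    <= - (836 / 10 ^+ 3 + 597 / 10 ^+ 6 + 315 / 10 ^+ 9 + 960 / 10 ^+ 12).
Proof.
have x0 : 0 < xr by rewrite /xr; lra.
have e : ln (7 * xr) - ln 3 = ln 7 - ln 3 + ln xr.
  by rewrite ?lnM ?lnXn ?posrE ?mulr_gt0 //; ring.
have /andP[h1 h2] : 10 / 10 ^+ 3 + 700 / 10 ^+ 6 + 544 / 10 ^+ 9 + 419 / 10 ^+ 12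
    <= ln (7 * xr) - ln 3
    <= 10 / 10 ^+ 3 + 700 / 10 ^+ 6 + 544 / 10 ^+ 9 + 426 / 10 ^+ 12.
  apply: (@ln_bounds R 3 _ _
    (5 / 10 ^+ 3 + 350 / 10 ^+ 6 + 221 / 10 ^+ 9 + 160 / 10 ^+ 12)
    (5 / 10 ^+ 3 + 350 / 10 ^+ 6 + 221 / 10 ^+ 9 + 161 / 10 ^+ 12));
    rewrite /= /xr; lra.
have [_ /andP[p1 p2] /andP[p3 p4] /andP[p5 p6]] := ln_primes_bounds; rewrite e in h1 h2.
apply/andP; split; move: p1 p2 p3 p4 p5 p6 h1 h2;
  move: (ln 2) (ln 3) (ln 5) (ln 7) (ln xr) => a b c d g; lra.
Qed.

Lemma ln_1Bxr_bounds :
  - (567 / 10 ^+ 3 + 717 / 10 ^+ 6 + 14 / 10 ^+ 9 + 442 / 10 ^+ 12)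
    <= ln (1 - xr)
    <= - (567 / 10 ^+ 3 + 717 / 10 ^+ 6 + 14 / 10 ^+ 9 + 431 / 10 ^+ 12).
Proof.
have x0 : 0 < 1 - xr by rewrite /xr; lra.
have e : ln (2 ^+ 2) - ln (7 * (1 - xr)) = 2 * ln 2 - ln 7 - ln (1 - xr).
  by rewrite ?lnM ?lnXn ?posrE ?mulr_gt0 //; ring.
have /andP[h1 h2] : 8 / 10 ^+ 3 + 101 / 10 ^+ 6 + 226 / 10 ^+ 9 + 497 / 10 ^+ 12
    <= ln (2 ^+ 2) - ln (7 * (1 - xr))
    <= 8 / 10 ^+ 3 + 101 / 10 ^+ 6 + 226 / 10 ^+ 9 + 504 / 10 ^+ 12.
  apply: (@ln_bounds R 3 _ _
    (4 / 10 ^+ 3 + 50 / 10 ^+ 6 + 591 / 10 ^+ 9 + 97 / 10 ^+ 12)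
    (4 / 10 ^+ 3 + 50 / 10 ^+ 6 + 591 / 10 ^+ 9 + 98 / 10 ^+ 12));
    rewrite /= /xr; lra.
have [_ /andP[p1 p2] /andP[p3 p4] /andP[p5 p6]] := ln_primes_bounds; rewrite e in h1 h2.
apply/andP; split; move: p1 p2 p3 p4 p5 p6 h1 h2;
  move: (ln 2) (ln 3) (ln 5) (ln 7) (ln (1 - xr)) => a b c d g; lra.
Qed.

Lemma ln_1Dxr_bounds :
  359 / 10 ^+ 3 + 897 / 10 ^+ 6 + 147 / 10 ^+ 9 + 56 / 10 ^+ 12
    <= ln (1 + xr)
    <= 359 / 10 ^+ 3 + 897 / 10 ^+ 6 + 147 / 10 ^+ 9 + 67 / 10 ^+ 12.
Proof.
have x0 : 0 < 1 + xr by rewrite /xr; lra.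
have e : ln (7 * (1 + xr)) - ln (2 * 5) = ln 7 + ln (1 + xr) - ln 2 - ln 5.
  by rewrite ?lnM ?lnXn ?posrE ?mulr_gt0 //; ring.
have /andP[h1 h2] : 3 / 10 ^+ 3 + 222 / 10 ^+ 6 + 203 / 10 ^+ 9 + 120 / 10 ^+ 12
    <= ln (7 * (1 + xr)) - ln (2 * 5)
    <= 3 / 10 ^+ 3 + 222 / 10 ^+ 6 + 203 / 10 ^+ 9 + 127 / 10 ^+ 12.
  apply: (@ln_bounds R 3 _ _
    (1 / 10 ^+ 3 + 611 / 10 ^+ 6 + 100 / 10 ^+ 9 + 167 / 10 ^+ 12)
    (1 / 10 ^+ 3 + 611 / 10 ^+ 6 + 100 / 10 ^+ 9 + 168 / 10 ^+ 12));
    rewrite /= /xr; lra.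
have [_ /andP[p1 p2] /andP[p3 p4] /andP[p5 p6]] := ln_primes_bounds; rewrite e in h1 h2.
apply/andP; split; move: p1 p2 p3 p4 p5 p6 h1 h2;
  move: (ln 2) (ln 3) (ln 5) (ln 7) (ln (1 + xr)) => a b c d g; lra.
Qed.

Lemma ln2_bounds :
  693 / 10 ^+ 3 + 147 / 10 ^+ 6 + 180 / 10 ^+ 9 + 558 / 10 ^+ 12 <= ln (2 : R)
    <= 693 / 10 ^+ 3 + 147 / 10 ^+ 6 + 180 / 10 ^+ 9 + 561 / 10 ^+ 12.
Proof. by case: ln_primes_bounds. Qed.

Lemma crit_xr_lt0 : crit xr < 0.
Proof.
have /andP[a1 a2] := ln2_bounds; have /andP[b1 b2] := ln_xr_bounds.
have /andP[c1 c2] := ln_1Bxr_bounds; have /andP[d1 d2] := ln_1Dxr_bounds.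
rewrite /crit /xlnx; move: a1 a2 b1 b2 c1 c2 d1 d2.
move: (ln xr) (ln (1 - xr)) (ln (1 + xr)) (ln 2) => p q r s; rewrite /xr; lra.
Qed.

Lemma ln_close (x y : R) : 0 < x -> 0 < y -> (x - y) / x <= ln x - ln y <= (x - y) / y.
Proof.
move=> x0 y0; have up (u v : R) : 0 < u -> 0 < v -> ln u - ln v <= (u - v) / v.
  move=> u0 v0; rewrite -ln_div ?posrE //; have uv : 0 < u / v by rewrite divr_gt0.
  have := @le_ln1Dx R (u / v - 1); rewrite (_ : 1 + (u / v - 1) = u / v); last by ring.
  have -> : (u - v) / v = u / v - 1 by field; rewrite gt_eqF.
  by apply; lra.
rewrite up // andbT; have := up y x y0 x0.
rewrite -[y - x]opprB mulNr; lra.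
Qed.

(** The logarithms at the left end are deduced with [ln_close] from those at the right end, at
    distance [1 / 10 ^+ 6], without new series. *)
Lemma crit_xl_gt0 : 0 < crit xl.
Proof.
have xl0 : 0 < xl by rewrite /xl; lra.
have xr0 : 0 < xr by rewrite /xr; lra.
have yl0 : 0 < 1 - xl by rewrite /xl; lra.
have yr0 : 0 < 1 - xr by rewrite /xr; lra.
have zl0 : 0 < 1 + xl by rewrite /xl; lra.
have zr0 : 0 < 1 + xr by rewrite /xr; lra.
have e : 24 / 10 ^+ 7 <= ln xr - ln xl + 1 / 10 ^+ 7 <= 25 / 10 ^+ 7.
  have /andP[h1 h2] := ln_close xr0 xl0; apply/andP; split.
    suff : 23 / 10 ^+ 7 <= (xr - xl) / xr by lra.
    by rewrite ler_pdivlMr // /xr /xl; lra.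
  suff : (xr - xl) / xl <= 24 / 10 ^+ 7 by lra.
  by rewrite ler_pdivrMr // /xr /xl; lra.
have f : 17 / 10 ^+ 7 <= ln (1 - xl) - ln (1 - xr) <= 18 / 10 ^+ 7.
  have /andP[h1 h2] := ln_close yl0 yr0; apply/andP; split.
    suff : 17 / 10 ^+ 7 <= (1 - xl - (1 - xr)) / (1 - xl) by lra.
    by rewrite ler_pdivlMr // /xr /xl; lra.
  suff : (1 - xl - (1 - xr)) / (1 - xr) <= 18 / 10 ^+ 7 by lra.
  by rewrite ler_pdivrMr // /xr /xl; lra.
have g : 69 / 10 ^+ 8 <= ln (1 + xr) - ln (1 + xl) <= 70 / 10 ^+ 8.
  have /andP[h1 h2] := ln_close zr0 zl0; apply/andP; split.
    suff : 69 / 10 ^+ 8 <= (1 + xr - (1 + xl)) / (1 + xr) by lra.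
    by rewrite ler_pdivlMr // /xr /xl; lra.
  suff : (1 + xr - (1 + xl)) / (1 + xl) <= 70 / 10 ^+ 8 by lra.
  by rewrite ler_pdivrMr // /xr /xl; lra.
move: e f g => /andP[e1 e2] /andP[f1 f2] /andP[g1 g2].
have /andP[a1 a2] := ln2_bounds; have /andP[b1 b2] := ln_xr_bounds.
have /andP[c1 c2] := ln_1Bxr_bounds; have /andP[d1 d2] := ln_1Dxr_bounds.
rewrite /crit /xlnx; move: a1 a2 b1 b2 c1 c2 d1 d2 e1 e2 f1 f2 g1 g2.
move: (ln xl) (ln (1 - xl)) (ln (1 + xl)) => p' q' r'.
move: (ln xr) (ln (1 - xr)) (ln (1 + xr)) (ln 2) => p q r s; rewrite /xl; lra.
Qed.

Lemma alpha_exists : exists2 alpha : R, xl < alpha < xr & crit alpha = 0.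
Proof.
have lr : xl < xr by rewrite /xl /xr; lra.
have [|c /andP[c1 c2] c0] := @intermediate_value R (@crit R) xl xr lr _
    (mulr_ge0_le0 (ltW crit_xl_gt0) (ltW crit_xr_lt0)).
  by move=> t /andP[t1 t2]; apply: cont_crit; move: t1 t2; rewrite /xl /xr; lra.
exists c => //; rewrite !lt_neqAle c1 c2 !andbT; apply/andP; split.
  by apply: contraTneq crit_xl_gt0 => ->; rewrite c0 ltxx.
by apply: contraTneq crit_xr_lt0 => <-; rewrite c0 ltxx.
Qed.

Lemma crit1_bound (x : R) : 4 / 10 <= x <= 44 / 100 -> `|crit1 x| <= 7.
Proof.
move=> /andP[x1 x2].
have x0 : 0 < x by lra.
have y0 : 0 < 1 - x by lra.
have z0 : 0 < 1 + x by lra.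
have p : - (15 / 10) <= ln x <= 0.
  have /andP[h _] := ln_close x0 (ltr01 : 0 < 1 :> R); rewrite ln1 subr0 in h.
  rewrite ln_le0 ?andbT; last lra.
  by apply: le_trans h; rewrite ler_pdivlMr //; lra.
have q : - (8 / 10) <= ln (1 - x) <= 0.
  have /andP[h _] := ln_close y0 (ltr01 : 0 < 1 :> R); rewrite ln1 subr0 in h.
  rewrite ln_le0 ?andbT; last lra.
  by apply: le_trans h; rewrite ler_pdivlMr //; lra.
have r : 0 <= ln (1 + x) <= 44 / 100.
  have /andP[_ h] := ln_close z0 (ltr01 : 0 < 1 :> R); rewrite ln1 subr0 divr1 in h.
  by rewrite ln_ge0 /=; lra.
have s : 0 <= ln (2 : R) <= 1.
  rewrite ln_ge0 /=; last lra.
  by have := @le_ln1Dx R 1; rewrite -[1 + 1](natrD _ 1 1) => -> //; lra.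
move: p q r s => /andP[p1 p2] /andP[q1 q2] /andP[r1 r2] /andP[s1 s2].
rewrite ler_norml /crit1 /xlnx; apply/andP; split; nra.
Qed.

(** Since [ratio] is stationary at [a], the error is quadratic in the width: [crit] is at least
    [-7 * (r - l)] by its derivative, and dividing by [64 / 100] gives a slope of at least
    [-11 * (r - l)]. *)
Lemma ratio_close (l r a : R) : 4 / 10 <= l -> r <= 44 / 100 -> l < a < r ->
  crit a = 0 -> crit r < 0 -> ratio r <= ratio a <= ratio r + 12 * (r - l) ^+ 2.
Proof.
move=> l0 r0 /andP[la ar] ca cr.
have a01 : 0 < a < 1 by apply/andP; split; lra.
have rb : a < r < 1 by rewrite ar /=; lra.
have r1 : r < 1 by case/andP: rb.
have a0 : 0 < a by case/andP: a01.
have [c [/andP[c1 c2] e]] := ratio_mean a0 ar r1.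
apply/andP; split.
  by apply/ltW/(ratio_decr a01 ca rb cr).
have t01 t : a <= t <= c -> 0 < t < 1 by move=> /andP[? ?]; apply/andP; split; lra.
have [||d [/andP[d1 d2] e2]] := @mean_value R (@crit R) (@crit1 R) a c c1.
- by move=> t /andP[t1 t2]; apply/isd_crit/t01; rewrite !ltW.
- by move=> t /t01 /andP[t0 t1]; apply: cont_crit; rewrite t0 ltW.
have : `|crit1 d| <= 7 by apply: crit1_bound; apply/andP; split; lra.
rewrite ler_norml => /andP[k1 k2].
rewrite ca subr0 in e2.
have w : 0 < c - a by lra.
have cc : - 7 * (r - l) <= crit c by rewrite e2; nra.
have v1 : 80 / 100 <= 1 - c ^+ 2 by rewrite expr2; nra.
have v : 64 / 100 <= (1 - c ^+ 2) ^+ 2 by rewrite [leRHS]expr2; nra.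
have v0 : 0 < (1 - c ^+ 2) ^+ 2 by lra.
have u : - (11 * (r - l)) <= crit c / (1 - c ^+ 2) ^+ 2 by rewrite ler_pdivlMr //; nra.
have u2 : - (11 * (r - l)) * (r - a) <= ratio r - ratio a.
  by rewrite e ler_wpM2r //; lra.
clear -l0 la ar u2; rewrite expr2; nra.
Qed.

(** An approximation of [gamma / ln 2], not of gamma itself. *)
Definition gamma_digits : R := 293 / 10 ^+ 3 + 236 / 10 ^+ 6 + 276 / 10 ^+ 9 + 200 / 10 ^+ 12.

Lemma layered_f_xr_bounds :
  (gamma_digits - 45 / 10 ^+ 12) * ln 2 * (1 - xr ^+ 2) <= layered_f xr
    <= (gamma_digits + 30 / 10 ^+ 12) * ln 2 * (1 - xr ^+ 2).
Proof.
have /andP[a1 a2] := ln2_bounds; have /andP[b1 b2] := ln_xr_bounds.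
have /andP[c1 c2] := ln_1Bxr_bounds; have /andP[d1 d2] := ln_1Dxr_bounds.
rewrite /layered_f; apply/andP; split; move: a1 a2 b1 b2 c1 c2 d1 d2;
  move: (ln xr) (ln (1 - xr)) (ln (1 + xr)) (ln 2) => p q r s; rewrite /gamma_digits /xr; lra.
Qed.

Lemma gamma_numeric (alpha : R) : xl < alpha < xr -> crit alpha = 0 ->
  `|ratio alpha / ln 2 - (2932 / 10 ^+ 4 + 3627 / 10 ^+ 8 + 62 / 10 ^+ 10)|
    < 2^-1 / 10 ^+ 10.
Proof.
move=> alpha_b ca.
have l2 : 0 < ln (2 : R) by rewrite ln_gt0 // ltr1n.
have h2 : 68 / 100 <= ln (2 : R) by have /andP[h _] := ln2_bounds; apply: le_trans h; lra.
have [r1 r2] : ratio xr <= ratio alpha /\ ratio alpha <= ratio xr + 12 / 10 ^+ 12.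
  have -> : 12 / 10 ^+ 12 = 12 * (xr - xl) ^+ 2 :> R by rewrite /xr /xl; field.
  have bl : 4 / 10 <= xl by rewrite /xl; lra.
  have br : xr <= 44 / 100 by rewrite /xr; lra.
  exact/andP/(ratio_close bl br alpha_b ca crit_xr_lt0).
have x2 : 0 < 1 - xr ^+ 2 by rewrite /xr; lra.
have [lo up] := andP layered_f_xr_bounds.
have glo : gamma_digits - 45 / 10 ^+ 12 <= ratio alpha / ln 2.
  by rewrite ler_pdivlMr //; apply: le_trans r1; rewrite /ratio ler_pdivlMr.
(* The error 12 of [ratio], divided by [ln 2 >= 68 / 100], is less than 18; with the 30 at [xr] this
   makes 48, below the tolerance of 50 in the same unit. *)
have gup : ratio alpha / ln 2 <= gamma_digits + 48 / 10 ^+ 12.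
  rewrite ler_pdivrMr //; apply: le_trans r2 _.
  have : ratio xr <= (gamma_digits + 30 / 10 ^+ 12) * ln 2 by rewrite /ratio ler_pdivrMr.
  by move: (ratio xr) (ln 2) (gamma_digits) h2 => k u C; clear; lra.
have -> : 2932 / 10 ^+ 4 + 3627 / 10 ^+ 8 + 62 / 10 ^+ 10 = gamma_digits.
  by rewrite /gamma_digits; clear; lra.
move: (ratio alpha / ln 2) (gamma_digits) glo gup => g C; clear.
by rewrite ltr_norml => *; apply/andP; split; lra.
Qed.
End Numerics.

(** * The limit, its numerical value and the shape of the maximizers *)

Lemma cvg_of_eps (R : realType) (u : nat -> R) (l : R) :
  (forall e : R, 0 < e -> exists N, forall n, (N <= n)%N -> `|u n - l| < e) ->
  (u n @[n --> \oo] --> l)%classic.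
Proof.
move=> h; apply/cvgrPdist_lt => e e0; have [N hN] := h e e0.
by exists N => // n /= Nn; rewrite distrC; apply: hN.
Qed.

Local Open Scope classical_set_scope.
Local Open Scope ring_scope.

Theorem theorem1p3 (R : realType) :
  exists alpha : R,
    unique (@critical_alpha R) alpha /\
    let gamma : R := layered_f alpha / (1 - alpha ^+ 2) in
    [/\ (ln (max_layered R n) / ln 2 / n%:R ^+ 2) @[n --> \oo]
          --> gamma / ln 2,
        `|gamma / ln 2
            - (2932 / 10 ^+ 4 + 3627 / 10 ^+ 8 + 62 / 10 ^+ 10)|
          < 2^-1 / 10 ^+ 10 &
        exists b : nat -> seq nat,
          (forall n : nat, exists w : 'S_n,
             is_layered_of (b n) w /\ Upsilon R w = max_layered R n) /\
          (forall i : nat, (0 < i)%N ->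
             ((nth 0%N (b n) i.-1)%:R / n%:R : R) @[n --> \oo]
               --> alpha ^+ i.-1 * (1 - alpha))].
Proof.
have [alpha /andP[al ar] ca] := @alpha_exists R.
have xl0 : 0 < bracket_left R by rewrite /bracket_left; lra.
have xr1 : bracket_right R < 1 by rewrite /bracket_right; lra.
have xlb : 0 < bracket_left R < alpha by rewrite xl0.
have xrb : alpha < bracket_right R < 1 by rewrite ar.
have a01 : 0 < alpha < 1 by rewrite (lt_trans xl0 al) (lt_trans ar xr1).
exists alpha; split.
  split; first by apply/critical_alphaE.
  by move=> y /critical_alphaE[y01 cy]; apply: crit_zero_unique.
rewrite -/(ratio alpha) => gamma; split.
- apply: cvg_of_eps => e e0.
  have l2 : 0 < ln (2 : R) by rewrite ln_gt0 // ltr1n.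
  have e1 : 0 < e / 2 * ln 2 by rewrite !mulr_gt0 ?invr_gt0.
  have [N hN] := gap_small a01 ca xlb xrb (@crit_xl_gt0 R) (@crit_xr_lt0 R) e1.
  exists N.+1 => n Nn; have n0 : 0 < (n%:R : R) by rewrite ltr0n (leq_trans _ Nn).
  have g0 := gap_ge0 a01 ca xlb xrb (@crit_xl_gt0 R) (@crit_xr_lt0 R) n.
  have gs := hN n (ltnW Nn).
  (* The distance to the limit is exactly the normalized gap, which is nonnegative and tends to
     0. *)
  have -> : ln (max_layered R n) / ln 2 / n%:R ^+ 2 - gamma / ln 2
      = - (gap alpha n / (ln 2 * n%:R ^+ 2)).
    by rewrite /gap /log_max /gamma; field; rewrite !gt_eqF.
  have p0 : 0 < ln 2 * n%:R ^+ 2 :> R by rewrite mulr_gt0 ?exprn_gt0.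
  rewrite normrN ger0_norm; last by rewrite divr_ge0 // ltW.
  rewrite ltr_pdivrMr //.
  apply: le_lt_trans gs _; rewrite -mulrA (ltr_pM2r p0); lra.
- by apply: gamma_numeric; rewrite ?al.
(* Any choice of maximizers works, since [optimal_cvg] is uniform over all optimal lists. *)
have [b hb] := choice (max_layered_attained R).
exists b; split=> // i i0; apply: cvg_of_eps => e e0.
have [N hN] := optimal_cvg a01 ca xlb xrb (@crit_xl_gt0 R) (@crit_xr_lt0 R) i.-1 e0.
exists N => n Nn; have [w [bw ew]] := hb n.
exact: hN (is_layered_optimal bw ew).
Qed.
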